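(* Let $1\le k\le n$ and $d$ be positive integers and $\delta\in(0,1)$. Let $x_1,\dots,x_n\in\mathbb R^d$ be the columns of a $d\times n$ matrix that satisfies the restricted isometry property of order $k$ with restricted isometry constant $\delta_k=\delta/k$. Let $w$ be drawn from a spherically symmetric probability distribution on $\mathbb R^d$, and define a random permutation $\pi$ of $[n]$ by sorting the indices $i\in[n]$ in order of increasing $w\cdot x_i$ (so $\pi(i)$ is the rank of $w\cdot x_i$). Then the resulting distribution over permutations of $[n]$ satisfies the $(k,\delta)$-uniform-induced-ordering property.
   Context: A matrix $X$ satisfies the restricted isometry property of order $k$ with restricted isometry constant $\delta_k$ if $(1-\delta_k)\|v\|^2\le\|X_Tv\|^2\le(1+\delta_k)\|v\|^2$ for every submatrix $X_T$ formed by $|T|\le k$ columns of $X$ and every $v\in\mathbb R^{|T|}$ (Euclidean norm). $(k,\delta)$-uniform-induced-ordering property of a distribution over permutations $\pi$ of $[n]$: for every $k$ distinct $y_1,\dots,y_k\in[n]$, $\Pr[\pi(y_1)<\dots<\pi(y_k)]\ge(1-\delta)/k!$.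
   Formalization: Ties among the w·x_i may be broken arbitrarily, except that on the event w = 0, where all values tie, π is required to be uniformly distributed; without this the claim fails, e.g. for w = 0 almost surely with ties broken by index. *)

(* Defs.v *)
From HB Require Import structures.
From mathcomp Require Import all_boot all_order all_algebra all_fingroup.
From mathcomp Require Import all_classical all_reals all_analysis.

Set Implicit Arguments.
Unset Strict Implicit.
Unset Printing Implicit Defensive.

Import Order.TTheory GRing.Theory Num.Theory.

Local Open Scope classical_set_scope.
Local Open Scope ring_scope.

Definition sqnorm (R : realType) (m : nat) (v : 'cV[R]_m) : R :=
  \sum_(i < m) v i ord0 ^+ 2.

Definition restricted_isometry (R : realType) (d n k : nat) (delta : R)
    (X : 'M[R]_(d, n)) : Prop :=
  forall S : {set 'I_n}, (#|S| <= k)%N ->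
  forall v : 'cV[R]_#|S|,
    (1 - delta) * sqnorm v
      <= sqnorm (colsub (fun j : 'I_#|S| => enum_val j) X *m v)
      <= (1 + delta) * sqnorm v.

(* A point of R^d is a d-tuple, since d.-tuple R carries the product
   sigma-algebra of the Borel sets of R, i.e. the Borel sets of R^d. *)
Definition tuple_col (R : realType) (d : nat) (w : d.-tuple R) : 'cV[R]_d :=
  \col_i tnth w i.

Definition linear_act (R : realType) (d : nat) (A : 'M[R]_d) (w : d.-tuple R)
    : d.-tuple R :=
  [tuple (A *m tuple_col w) i ord0 | i < d].

Definition spherically_symmetric (R : realType) (d : nat)
    (mu : set (d.-tuple R) -> \bar R) : Prop :=
  forall Q : 'M[R]_d, Q^T *m Q = 1%:M ->
  forall A : set (d.-tuple R), measurable A -> mu (linear_act Q @^-1` A) = mu A.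

Definition inner (R : realType) (d : nat) (w : d.-tuple R) (x : 'cV[R]_d) : R :=
  \sum_(i < d) tnth w i * x i ord0.

Definition sorts_by (R : realType) (n : nat) (f : 'I_n -> R) (s : 'S_n) : Prop :=
  forall i j : 'I_n, f i < f j -> (s i < s j)%N.

(* The random permutation pi sorts the indices by increasing w . x_i, where x_i
   is the i-th column of X.  Ties may be broken arbitrarily, except on the event
   w = 0, where every w . x_i vanishes: there pi must be uniformly distributed.
   The last clause is void when w <> 0 almost surely, and cannot be dropped: for
   w = 0 almost surely, a deterministic tie-breaking rule gives a constant
   permutation. *)
Definition sorting_permutation (disp : measure_display) (T : measurableType disp)
    (R : realType) (P : probability T R) (d n : nat) (X : 'M[R]_(d, n))
    (w : T -> d.-tuple R) (pi : T -> 'S_n) : Prop :=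
  [/\ forall s : 'S_n, measurable [set t | pi t = s],
      forall t : T, sorts_by (fun i => inner (w t) (col i X)) (pi t) &
      forall s : 'S_n, P [set t | tuple_col (w t) = 0%R /\ pi t = s]
        = (P [set t | tuple_col (w t) = 0%R] * (n`!%:R^-1)%:E)%E].

Definition uniform_induced_ordering (disp : measure_display)
    (T : measurableType disp) (R : realType) (P : probability T R) (n : nat)
    (pi : T -> 'S_n) (k : nat) (delta : R) : Prop :=
  forall y : k.-tuple 'I_n, uniq y ->
    (((1 - delta) / k`!%:R)%:E
      <= P [set t | sorted ltn [seq nat_of_ord (pi t i) | i <- y]])%E.

(* Main.v *)
(** The law of [w] enters only through the direction of [w].  Let [Y] be the matrix of
    the [k] chosen columns and [Y = U S] its QR decomposition.  Then [U^T w] is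
    spherically symmetric in [R^k], and the ordering event says that [S^T (U^T w)] lies in
    the cone [K] of increasing vectors.

    On open cones every spherically symmetric measure is proportional to Lebesgue measure
    [lam] on the unit ball [B] (Christensen's argument on uniformly distributed measures).
    Translation invariance determines [lam] up to a factor, so an invertible [L] multiplies
    [lam] by a constant, and comparing [L B] with balls bounds this constant.  If
    [a |v| <= |L v| <= b |v|] for all [v], this gives
    [lam (L^-1 K `&` B) >= (a / b)^k lam (K `&` B)], while [lam (K `&` B) = lam B / k!] by
    symmetry under permutations of the coordinates.  The restricted isometry property gives
    [a^2 = 1 - delta / k] and [b^2 = 1 + delta / k] for [L = S^T], whence
    [(a / b)^k >= (1 - delta / k)^k >= 1 - delta].  On the event [w = 0] the permutation
    is uniform, and a counting argument suffices. *)

Require Import Defs.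
From HB Require Import structures.
From mathcomp Require Import all_boot all_order all_algebra all_fingroup.
From mathcomp Require Import all_classical all_reals all_analysis.
From mathcomp Require Import measurable_realfun.
From mathcomp Require Import ring lra.

Set Implicit Arguments.
Unset Strict Implicit.
Unset Printing Implicit Defensive.

Import Order.TTheory GRing.Theory Num.Theory.

Local Open Scope classical_set_scope.
Local Open Scope ring_scope.

(** * Euclidean geometry *)

Section Euclidean.
Variable R : realType.

Definition dot (m : nat) (u v : 'cV[R]_m) : R := \sum_(i < m) u i ord0 * v i ord0.

Definition enorm (m : nat) (v : 'cV[R]_m) : R := Num.sqrt (sqnorm v).

Section Basics.
Variable m : nat.
Implicit Types u v w : 'cV[R]_m.

Lemma dotE u v : dot u v = (u^T *m v) ord0 ord0.
Proof. by rewrite mxE; apply: eq_bigr => i _; rewrite mxE. Qed.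

Lemma dotC u v : dot u v = dot v u.
Proof. by apply: eq_bigr => i _; rewrite mulrC. Qed.

Lemma dotDl u v w : dot (u + v) w = dot u w + dot v w.
Proof. by rewrite -big_split; apply: eq_bigr => i _; rewrite mxE mulrDl. Qed.

Lemma dotDr u v w : dot u (v + w) = dot u v + dot u w.
Proof. by rewrite dotC dotDl !(dotC u). Qed.

Lemma dotZl a u v : dot (a *: u) v = a * dot u v.
Proof. by rewrite mulr_sumr; apply: eq_bigr => i _; rewrite mxE mulrA. Qed.

Lemma dotZr a u v : dot u (a *: v) = a * dot u v.
Proof. by rewrite dotC dotZl dotC. Qed.

Lemma dotNl u v : dot (- u) v = - dot u v.
Proof. by rewrite -scaleN1r dotZl mulN1r. Qed.

Lemma dotNr u v : dot u (- v) = - dot u v.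
Proof. by rewrite dotC dotNl dotC. Qed.

Lemma sqnormE v : sqnorm v = dot v v.
Proof. by apply: eq_bigr => i _; rewrite expr2. Qed.

Lemma sqnorm_ge0 v : 0 <= sqnorm v.
Proof. by apply: sumr_ge0 => i _; apply: sqr_ge0. Qed.

Lemma sqnorm_eq0 v : (sqnorm v == 0) = (v == 0).
Proof.
rewrite psumr_eq0 => [|i _]; last exact: sqr_ge0.
apply/allP/eqP => [v0|-> i _]; last by rewrite /= mxE expr0n /= eqxx.
apply/colP => i; rewrite mxE; apply/eqP.
by have := v0 i (mem_index_enum i); rewrite /= sqrf_eq0.
Qed.

Lemma sqnormZ a v : sqnorm (a *: v) = a ^+ 2 * sqnorm v.
Proof. by rewrite !sqnormE dotZl dotZr mulrA expr2. Qed.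

(** The squared norm of [sqnorm v *: u - dot u v *: v] is nonnegative, and it factors as [sqnorm v]
    times the difference of the two sides. *)
Lemma cauchy_schwarz u v : dot u v ^+ 2 <= sqnorm u * sqnorm v.
Proof.
have [->|v0] := eqVneq v 0.
  have -> : dot u 0 = 0 by rewrite -(scale0r 0) dotZr mul0r.
  by rewrite expr0n mulr_ge0 ?sqnorm_ge0.
have vp : 0 < sqnorm v by rewrite lt_def sqnorm_eq0 v0 sqnorm_ge0.
have := sqnorm_ge0 (sqnorm v *: u - dot u v *: v).
rewrite sqnormE !(dotDl, dotDr, dotNl, dotNr, dotZl, dotZr) (dotC v u) -!sqnormE.
rewrite (_ : _ + _ = sqnorm v * (sqnorm u * sqnorm v - dot u v ^+ 2)); last by ring.
by rewrite pmulr_rge0// subr_ge0.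
Qed.

Lemma enorm_ge0 v : 0 <= enorm v.
Proof. exact: sqrtr_ge0. Qed.

Lemma sqr_enorm v : enorm v ^+ 2 = sqnorm v.
Proof. by rewrite sqr_sqrtr ?sqnorm_ge0. Qed.

Lemma enorm_eq0 v : (enorm v == 0) = (v == 0).
Proof. by rewrite sqrtr_eq0 le_eqVlt sqnorm_eq0 ltNge sqnorm_ge0 orbF. Qed.

Lemma enorm0 : enorm (0 : 'cV[R]_m) = 0.
Proof. by apply/eqP; rewrite enorm_eq0. Qed.

Lemma enorm_gt0 v : (0 < enorm v) = (v != 0).
Proof. by rewrite lt_def enorm_eq0 enorm_ge0 andbT. Qed.

Lemma enormZ a v : enorm (a *: v) = `|a| * enorm v.
Proof. by rewrite /enorm sqnormZ sqrtrM ?sqr_ge0// sqrtr_sqr. Qed.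

Lemma enormN v : enorm (- v) = enorm v.
Proof. by rewrite -scaleN1r enormZ normrN1 mul1r. Qed.

Lemma dot_le_enorm u v : dot u v <= enorm u * enorm v.
Proof.
apply: le_trans (ler_norm _) _.
rewrite -(@ler_pXn2r _ 2)// ?nnegrE ?mulr_ge0 ?enorm_ge0//.
by rewrite real_normK ?num_real// exprMn !sqr_enorm cauchy_schwarz.
Qed.

Lemma enormD u v : enorm (u + v) <= enorm u + enorm v.
Proof.
rewrite -(@ler_pXn2r _ 2)// ?nnegrE ?addr_ge0 ?enorm_ge0//.
rewrite sqrrD !sqr_enorm !sqnormE !(dotDl, dotDr) (dotC v u).
have := dot_le_enorm u v; lra.
Qed.

Lemma coord_le_enorm v i : `|v i ord0| <= enorm v.
Proof.
rewrite -(@ler_pXn2r _ 2)// ?nnegrE ?enorm_ge0//.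
rewrite sqr_enorm /sqnorm (bigD1 i)//= real_normK ?num_real// lerDl.
by apply: sumr_ge0 => j _; apply: sqr_ge0.
Qed.

(** The coordinates are summed with weak bounds; strictness comes from [m%:R * a ^+ 2 < e ^+ 2], so
    [m = 0] is not a special case. *)
Lemma enorm_lt_of_coord v (a e : R) : 0 <= a -> m%:R * a ^+ 2 < e ^+ 2 -> 0 <= e ->
  (forall i, `|v i ord0| < a) -> enorm v < e.
Proof.
move=> a0 ae e0 va; rewrite -(@ltr_pXn2r _ 2)// ?nnegrE ?enorm_ge0// sqr_enorm.
apply: le_lt_trans ae; rewrite mulr_natl -[X in _ *+ X]card_ord -sumr_const; apply: ler_sum => i _.
by rewrite -[leLHS]real_normK ?num_real// ler_pXn2r ?nnegrE// ltW.
Qed.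

End Basics.

Lemma dot_mulmx (m n : nat) (A : 'M[R]_(m, n)) u v :
  dot (A *m u) v = dot u (A^T *m v).
Proof. by rewrite !dotE trmx_mul mulmxA. Qed.

Lemma sqnorm_isometry (m n : nat) (Q : 'M[R]_(m, n)) v :
  Q^T *m Q = 1%:M -> sqnorm (Q *m v) = sqnorm v.
Proof. by move=> QQ; rewrite !sqnormE dot_mulmx mulmxA QQ mul1mx. Qed.

Lemma enorm_isometry (m n : nat) (Q : 'M[R]_(m, n)) v :
  Q^T *m Q = 1%:M -> enorm (Q *m v) = enorm v.
Proof. by move=> QQ; rewrite /enorm sqnorm_isometry. Qed.

(* Householder reflection in the bisector of the two directions. *)
Lemma orthogonal_align (m : nat) (u v : 'cV[R]_m) : u != 0 -> v != 0 ->
  exists2 Q : 'M[R]_m, Q^T *m Q = 1%:M & Q *m (enorm v *: u) = enorm u *: v.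
Proof.
move=> u0 v0; set x := enorm v *: u; set y := enorm u *: v.
have [xy|xy] := eqVneq x y.
  by exists 1%:M; rewrite ?trmx1 ?mulmx1// mul1mx.
have sxy : sqnorm x = sqnorm y by rewrite !sqnormZ !sqr_enorm mulrC.
set z := x - y; set c := sqnorm z.
have zp : c != 0 by rewrite sqnorm_eq0 subr_eq0.
have zz : z^T *m z = c%:M.
  by apply/matrixP => i j; rewrite !ord1 -dotE -sqnormE mxE eqxx mulr1n.
(* Equality of the norms of [x] and [y] gives this identity; with it the reflection along [z]
   subtracts exactly [z] from [x]. *)
have cE : c = 2 * dot z x.
  rewrite /c /z sqnormE !(dotDl, dotDr, dotNl, dotNr) (dotC x y) -!sqnormE sxy.
  by ring.
exists (1%:M - (2 / c) *: (z *m z^T)).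
  rewrite (raddfB (@trmx R m m)) /= trmx1 linearZ /= trmx_mul trmxK.
  rewrite mulmxBl mul1mx mulmxBr mulmx1 -scalemxAl -scalemxAr.
  rewrite -mulmxA (mulmxA z^T) zz mul_scalar_mx -scalemxAr !scalerA.
  rewrite opprB -addrA -scalerBl -scaleNr -scalerDl.
  by rewrite [X in X *: _](_ : _ = 0) ?scale0r ?addr0//; field.
rewrite mulmxBl mul1mx -scalemxAl -mulmxA.
have -> : z^T *m x = (dot z x)%:M.
  by apply/matrixP => i j; rewrite !ord1 -dotE mxE eqxx mulr1n.
rewrite mul_mx_scalar scalerA.
have -> : 2 / c * dot z x = 1 by rewrite mulrAC -cE divff.
by rewrite scale1r /z opprB addrC subrK.
Qed.

(** A row of [kermx S^T] is the transpose of a vector killed by [S], hence zero. *)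
Lemma mulmx_inj_unitmx_tr (k : nat) (S : 'M[R]_k) :
  (forall v : 'cV_k, S *m v = 0 -> v = 0) -> S^T \in unitmx.
Proof.
move=> Sinj; rewrite -row_free_unit -kermx_eq0; apply/eqP/row_matrixP => i.
rewrite row0; apply: (can_inj (@trmxK _ _ _)); rewrite trmx0; apply: Sinj.
have -> : S *m (row i (kermx S^T))^T = (row i (kermx S^T *m S^T))^T.
  by rewrite [in RHS]row_mul trmx_mul trmxK.
by rewrite mulmx_ker row0 trmx0.
Qed.

(** Gram-Schmidt by induction on the number of columns: the first column is orthogonalised against
    the others, so [S] comes out lower triangular. *)
Lemma qr_decomposition (d k : nat) (Y : 'M[R]_(d, k)) :
  (forall v : 'cV_k, Y *m v = 0 -> v = 0) ->
  exists U : 'M[R]_(d, k), exists2 S : 'M[R]_k, U^T *m U = 1%:M & Y = U *m S.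
Proof.
elim: k Y => [|k IH] Y Yinj.
  exists 0, 0; first by apply/matrixP => [[]].
  by apply/matrixP => ? [].
have Ymul (a : 'M[R]_1) (v : 'cV_k) :
    Y *m (@col_mx R 1 k 1 a v) = (@lsubmx R d 1 k Y) *m a + (@rsubmx R d 1 k Y) *m v.
  by rewrite -mul_row_col hsubmxK.
have Yinj' (v : 'cV_k) : (@rsubmx R d 1 k Y) *m v = 0 -> v = 0.
  move=> Yv0; have := Yinj (@col_mx _ 1 k 1 0 v).
  rewrite Ymul mulmx0 add0r => /(_ Yv0) v0.
  by have := congr1 (@dsubmx _ 1 k 1) v0; rewrite col_mxKd linear0.
have [U [S UU YE]] := IH _ Yinj'.
set y := @lsubmx R d 1 k Y.
set z : 'cV[R]_d := y - U *m (U^T *m y).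
have z0 : z != 0.
  apply/eqP => z0; have Sinj (v : 'cV_k) : S *m v = 0 -> v = 0.
    by move=> Sv; apply: Yinj'; rewrite YE -mulmxA Sv mulmx0.
  have Sunit : S \in unitmx by rewrite -unitmx_tr; exact: mulmx_inj_unitmx_tr.
  (* If [z = 0], the first column is a combination of the others with coefficients
     [invmx S *m (U^T *m y)]. This gives a kernel vector of [Y] with first entry 1. *)
  have := Yinj (@col_mx _ 1 k 1 1%:M (- (invmx S *m (U^T *m y)))).
  rewrite Ymul mulmx1 -/y YE.
  rewrite mulmxN -mulmxA mulKVmx// -/z => /(_ z0) v0.
  have /matrixP/(_ ord0 ord0) := congr1 (@usubmx _ 1 k 1) v0.
  by rewrite col_mxKu !mxE eqxx => /eqP; rewrite oner_eq0.
have Uz : U^T *m z = 0 by rewrite mulmxBr !mulmxA UU mul1mx subrr.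
set u := (enorm z)^-1 *: z.
have zn0 : enorm z != 0 by rewrite enorm_eq0.
have uu : u^T *m u = 1%:M.
  apply/matrixP => i j; rewrite !ord1 -dotE -sqnormE sqnormZ -sqr_enorm.
  by rewrite -exprMn mulVf// expr1n mxE eqxx.
have Uu : U^T *m u = 0 by rewrite -scalemxAr Uz scaler0.
exists (@row_mx _ d 1 k u U).
exists (@block_mx _ 1 k 1 k (enorm z)%:M 0 (U^T *m y) S).
  transitivity (block_mx (u^T *m u) (u^T *m U) (U^T *m u) (U^T *m U)).
    by rewrite -mul_col_row -tr_row_mx.
  rewrite uu UU Uu -[u^T *m U]trmxK trmx_mul trmxK Uu trmx0.
  by rewrite -scalar_mx_block.
transitivity (row_mx u U *m block_mx (enorm z)%:M 0 (U^T *m y) S); last by [].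
rewrite mul_row_block mulmx0 add0r -YE mul_mx_scalar scalerA mulfV// scale1r.
by rewrite /z subrK hsubmxK.
Qed.

(** A matrix and its transpose have the same singular values. Here Cauchy-Schwarz is applied to
    [|v|^2 = <S^-1 v, S^T v>] for the lower bound and to [|S^T v|^2 = <v, S S^T v>] for the upper
    one. *)
Lemma trmx_bounds (k : nat) (S : 'M[R]_k) (a b : R) : 0 < a -> 0 < b ->
  (forall v, a * enorm v <= enorm (S *m v) <= b * enorm v) ->
  S^T \in unitmx /\ forall v, a * enorm v <= enorm (S^T *m v) <= b * enorm v.
Proof.
move=> a0 b0 Sab.
have Sinj (v : 'cV_k) : S *m v = 0 -> v = 0.
  move=> Sv; have /andP[+ _] := Sab v; rewrite Sv enorm0 pmulr_rle0// => v0.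
  by apply/eqP; rewrite -enorm_eq0 eq_le v0 enorm_ge0.
have Sunit := mulmx_inj_unitmx_tr Sinj.
split=> // v; apply/andP; split.
  have [->|v0] := eqVneq v 0; first by rewrite mulmx0 enorm0 mulr0.
  have Su : S \in unitmx by rewrite -unitmx_tr.
  have : sqnorm v <= enorm (invmx S *m v) * enorm (S^T *m v).
    by apply: le_trans (dot_le_enorm _ _); rewrite -dot_mulmx mulKVmx// sqnormE.
  have /andP[+ _] := Sab (invmx S *m v); rewrite mulKVmx// => h1 h2.
  have vp : 0 < enorm v by rewrite enorm_gt0.
  rewrite -(ler_pM2r vp) -mulrA -expr2 sqr_enorm.
  apply: le_trans (_ : a * (enorm (invmx S *m v) * enorm (S^T *m v)) <= _).
    by rewrite ler_pM2l.
  by rewrite mulrA mulrC ler_wpM2l ?enorm_ge0.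
have [->|v0] := eqVneq (S^T *m v) 0; first by rewrite enorm0 mulr_ge0 ?enorm_ge0// ltW.
have vp : 0 < enorm (S^T *m v) by rewrite enorm_gt0.
rewrite -(ler_pM2r vp) -expr2 sqr_enorm sqnormE dot_mulmx trmxK.
apply: le_trans (dot_le_enorm _ _) _.
have /andP[_ h] := Sab (S^T *m v).
by rewrite mulrAC [b * _ * _]mulrC ler_wpM2l ?enorm_ge0.
Qed.

End Euclidean.

(** * Lebesgue measure on tuples *)

Section Tuples.
Variable R : realType.

Definition col_tuple (m : nat) (v : 'cV[R]_m) : m.-tuple R := [tuple v i ord0 | i < m].

Lemma col_tupleK (m : nat) : cancel (@col_tuple m) (@tuple_col R m).
Proof. by move=> v; apply/colP => i; rewrite mxE tnth_mktuple. Qed.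

Lemma tuple_colK (m : nat) : cancel (@tuple_col R m) (@col_tuple m).
Proof. by move=> x; apply: eq_from_tnth => i; rewrite tnth_mktuple mxE. Qed.

Definition shift_tuple (m : nat) (v : 'cV[R]_m) (x : m.-tuple R) : m.-tuple R :=
  col_tuple (v + tuple_col x).

Lemma measurable_preimageT d1 d2 (T1 : measurableType d1) (T2 : measurableType d2)
  (f : T1 -> T2) A : measurable_fun setT f -> measurable A -> measurable (f @^-1` A).
Proof. by move=> mf mA; rewrite -[_ @^-1` _]setTI; exact: mf. Qed.

Lemma measurable_col_tuple d (T : measurableType d) (m : nat) (f : T -> 'cV[R]_m) :
  (forall i, measurable_fun setT (fun t => f t i ord0)) ->
  measurable_fun setT (fun t => col_tuple (f t)).
Proof.
move=> mf; apply/measurable_fun_tnthP => i.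
by apply: eq_measurable_fun (mf i) => t _ /=; rewrite tnth_mktuple.
Qed.

Lemma measurable_tuple_col (m : nat) (i : 'I_m) :
  measurable_fun setT (fun x : m.-tuple R => tuple_col x i ord0).
Proof. by apply: eq_measurable_fun (measurable_tnth i) => x _; rewrite mxE. Qed.

Lemma measurable_mulmx d (T : measurableType d) (m n : nat) (A : 'M[R]_(m, n))
    (f : T -> 'cV[R]_n) :
  (forall i, measurable_fun setT (fun t => f t i ord0)) ->
  forall i, measurable_fun setT (fun t => (A *m f t) i ord0).
Proof.
move=> mf i; under eq_fun do rewrite mxE.
by apply: measurable_sum => j; apply: measurable_funM => //; exact: measurable_cst.
Qed.

Lemma measurable_addmx d (T : measurableType d) (m : nat) (f g : T -> 'cV[R]_m) :
  (forall i, measurable_fun setT (fun t => f t i ord0)) ->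
  (forall i, measurable_fun setT (fun t => g t i ord0)) ->
  forall i, measurable_fun setT (fun t => (f t + g t) i ord0).
Proof.
by move=> mf mg i; under eq_fun do rewrite mxE; exact: measurable_funD.
Qed.

Lemma measurable_shift_tuple (m : nat) (v : 'cV[R]_m) :
  measurable_fun setT (shift_tuple v).
Proof.
apply: measurable_col_tuple; apply: measurable_addmx => i.
  exact: measurable_cst.
exact: measurable_tuple_col.
Qed.

(** The image measure agrees with Lebesgue measure on half-open intervals, which determine it. *)
Lemma lebesgue_measure_shift (v : R) (A : set R) : measurable A ->
  lebesgue_measure ((fun x => v + x) @^-1` A) = lebesgue_measure A.
Proof.
pose f : measurableTypeR R -> measurableTypeR R := fun x => v + x.
have mf : measurable_fun setT f by apply: measurable_funD => //; exact: measurable_cst.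
move=> mA; apply/esym.
rewrite -[RHS]/(pushforward (@lebesgue_measure R) f A).
apply: lebesgue_measure_unique => // _ [[a b]] _ <-.
rewrite /= /pushforward (_ : f @^-1` _ = `]a - v, b - v]%classic); last first.
  by apply/seteqP; split => x; rewrite /= /f !in_itv/= ltrBlDl lerBrDl.
rewrite !lebesgue_measure_itv/= !lte_fin ltrD2r.
by rewrite -!EFinB opprB addrA subrK.
Qed.

(** The volume of a sup-norm cube passes directly through products, so cubes serve to normalise the
    measure and to show that balls have positive finite volume. *)
Definition box (m : nat) (a : R) : set (m.-tuple R) := [set x | forall i, `|tnth x i| < a].

Arguments box : clear implicits.

Lemma measurable_box m a : measurable (box m a).
Proof.
have -> : box m a = \bigcap_(i in [set: 'I_m]) (@tnth m R ^~ i @^-1` `]-a, a[%classic).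
  apply/seteqP; split=> [x xa i _|x xa i]/=; first by rewrite in_itv/= -ltr_norml.
  by have := xa i I; rewrite /= in_itv/= -ltr_norml.
apply: fin_bigcap_measurable => // i _.
by apply: measurable_preimageT => //; exact: measurable_tnth.
Qed.

(** * Lebesgue measure in one more dimension *)

Section LebesgueCons.
Variables (m : nat) (lam : {sigma_finite_measure set (m.-tuple R) -> \bar R}).

Definition pair_cons (p : R * m.-tuple R) : m.+1.-tuple R := [the m.+1.-tuple R of p.1 :: p.2].

Lemma measurable_pair_cons : measurable_fun setT pair_cons.
Proof. exact: measurable_cons. Qed.

Definition cons_measure : set (m.+1.-tuple R) -> \bar R :=
  pushforward ((@lebesgue_measure R) \x lam)%E pair_cons.

Let cons_measure0 : cons_measure set0 = 0%E.
Proof. by rewrite /cons_measure /pushforward preimage_set0 measure0. Qed.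

Let cons_measure_ge0 A : (0 <= cons_measure A)%E.
Proof. by rewrite /cons_measure /pushforward; exact: measure_ge0. Qed.

Let cons_measure_additive : semi_sigma_additive cons_measure.
Proof.
rewrite /cons_measure; apply: measure_semi_sigma_additive.
exact: measurable_pair_cons.
Qed.

HB.instance Definition _ := isMeasure.Build _ _ _ cons_measure
  cons_measure0 cons_measure_ge0 cons_measure_additive.

Lemma cons_measure_rectangle (A : set R) (B : set (m.-tuple R)) (C : set (m.+1.-tuple R)) :
  measurable A -> measurable B -> (forall x y, C (pair_cons (x, y)) <-> A x /\ B y) ->
  cons_measure C = (lebesgue_measure A * lam B)%E.
Proof.
move=> mA mB CAB; rewrite -product_measure1E// /cons_measure /pushforward.
by congr product_measure1; apply/seteqP; split => -[x y] /CAB.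
Qed.

Lemma cons_measure_box a : 0 <= a ->
  lam (box m a) = ((2 * a) ^+ m)%:E -> cons_measure (box m.+1 a) = ((2 * a) ^+ m.+1)%:E.
Proof.
move=> a0 lama; rewrite (@cons_measure_rectangle `]-a, a[%classic (box m a)).
- rewrite lama lebesgue_measure_itv/= lte_fin opprK exprS EFinM; congr (_ * _)%E.
  case: ltP => [_|]; first by congr EFin; ring.
  by move=> aa; have -> : a = 0 by [lra]; rewrite mulr0.
- exact: measurable_itv.
- exact: measurable_box.
move=> x y; rewrite /= in_itv/= -ltr_norml; split=> [xy|[xa ya] i].
  split=> [|i]; first by have := xy ord0.
  by have := xy (lift ord0 i); rewrite tnthS.
by case: (unliftP ord0 i) => [j|] ->; rewrite ?tnthS// tnth0.
Qed.

(** Cubes of natural half-side exhaust the space. Sigma-finiteness is what allows the next product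
    to be formed. *)
Lemma cons_measure_sigma_finite :
  (forall a, 0 <= a -> lam (box m a) = ((2 * a) ^+ m)%:E) -> sigma_finite setT cons_measure.
Proof.
move=> lamE; exists (fun n => box m.+1 n%:R).
  apply/seteqP; split=> // x _.
  exists (Num.bound (enorm (tuple_col x))) => // i.
  apply: le_lt_trans (archi_boundP (enorm_ge0 _)).
  by have := coord_le_enorm (tuple_col x) i; rewrite mxE.
move=> n; split; first exact: measurable_box.
by rewrite cons_measure_box ?lamE// ltry.
Qed.

(** A translation acts separately on the head and on the tail, so its effect on the product measure
    can be checked on rectangles. *)
Lemma cons_measure_shift :
  (forall v A, measurable A -> lam (shift_tuple v @^-1` A) = lam A) ->
  forall v A, measurable A -> cons_measure (shift_tuple v @^-1` A) = cons_measure A.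
Proof.
move=> lamS v A mA.
pose v' : 'cV[R]_m := \col_i v (lift ord0 i) ord0.
pose f (p : measurableTypeR R * m.-tuple R) : measurableTypeR R * m.-tuple R :=
  (v ord0 ord0 + p.1, shift_tuple v' p.2).
have mf : measurable_fun setT f.
  apply/measurable_fun_pairP; split.
    by apply: measurable_funD => //; exact: measurable_cst.
  exact: (measurableT_comp (measurable_shift_tuple v') measurable_snd).
rewrite /cons_measure /pushforward.
transitivity (pushforward ((@lebesgue_measure R) \x lam)%E f (pair_cons @^-1` A)).
  rewrite /pushforward; congr product_measure1; apply: funext => -[x y] /=.
  congr (A _); apply: eq_from_tnth => i; rewrite tnth_mktuple !mxE.
  case: (unliftP ord0 i) => [j|] ->; rewrite ?tnth0// !tnthS tnth_mktuple !mxE//.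
apply/esym; apply: product_measure_unique => //=.
  move=> B C mB mC; rewrite /pushforward -(lamS v' C mC).
  rewrite -(lebesgue_measure_shift (v ord0 ord0) mB) -product_measure1E//.
    apply: measurable_preimageT mB.
    by apply: (@measurable_funD _ _ _ _ (cst _) id) => //; exact: measurable_cst.
  by apply: measurable_preimageT => //; exact: measurable_shift_tuple.
by apply: measurable_preimageT => //; exact: measurable_pair_cons.
Qed.

End LebesgueCons.
(** Induction on the dimension. Translation invariance and the volume of cubes are the two
    properties through which the measure is used afterwards. *)
Lemma lebesgue_tuple_exists (m : nat) :
  exists lam : {sigma_finite_measure set (m.-tuple R) -> \bar R},
    (forall v A, measurable A -> lam (shift_tuple v @^-1` A) = lam A) /\
    (forall a, 0 <= a -> lam (box m a) = ((2 * a) ^+ m)%:E).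
Proof.
elim: m => [|m [lam [lamS lamB]]].
  have T0 (x : 0.-tuple R) : x = [tuple] by exact: tuple0.
  (* In dimension 0 the space is one point, and every cube must have volume [(2 * a) ^+ 0 = 1]. *)
  exists [the {sigma_finite_measure set _ -> \bar R} of dirac ([tuple] : 0.-tuple R)].
  split=> [v A mA|a a0] /=.
    rewrite (_ : _ @^-1` A = A)//; apply: funext => x /=; congr (A _).
    by rewrite (T0 x) (T0 (shift_tuple _ _)).
  by rewrite expr0 diracE mem_set// => -[].
pose mix := Measure_isSigmaFinite.Build _ _ _ _ (cons_measure_sigma_finite lamB).
pose lam' : {sigma_finite_measure set _ -> \bar R} := HB.pack (cons_measure lam) mix.
exists lam'; split; first exact: cons_measure_shift.
by move=> a a0; apply: cons_measure_box => //; exact: (lamB _ a0).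
Qed.

End Tuples.

Arguments box {R} m a.
Arguments measurable_box {R} m a.

(** * Linear images of translation-invariant measures *)

Section Sections.
Context d1 d2 (T1 : measurableType d1) (T2 : measurableType d2) (R : realType).
Variables (m1 : {sigma_finite_measure set T1 -> \bar R})
          (m2 : {sigma_finite_measure set T2 -> \bar R}).
Local Open Scope ereal_scope.

(** Both iterated integrals are product measures of [D], and these agree on rectangles. *)
Lemma integral_sections_swap (D : set (T1 * T2)) : measurable D ->
  \int[m1]_x m2 [set y | D (x, y)] = \int[m2]_y m1 [set x | D (x, y)].
Proof.
move=> mD; transitivity ((m1 \x m2) D).
  by apply: eq_integral => x _ /=; rewrite xsectionE.
rewrite (@product_measure_unique _ _ _ _ _ m1 m2 (m1 \x^ m2))//.
  by apply: eq_integral => x _ /=; rewrite ysectionE.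
by move=> A B mA mB; rewrite /= product_measure2E.
Qed.

Lemma measurable_fun_sections1 (D : set (T1 * T2)) : measurable D ->
  measurable_fun setT (fun x => m2 [set y | D (x, y)]).
Proof.
move=> mD; apply: eq_measurable_fun (measurable_fun_xsection m2 mD) => x _ /=.
by rewrite xsectionE.
Qed.

Lemma measurable_fun_sections2 (D : set (T1 * T2)) : measurable D ->
  measurable_fun setT (fun y => m1 [set x | D (x, y)]).
Proof.
move=> mD; apply: eq_measurable_fun (measurable_fun_ysection m1 mD) => x _ /=.
by rewrite ysectionE.
Qed.

End Sections.

(** Used from right to left: a product of two masses becomes an integral of section masses, to which
    the exchange of integrals applies. *)
Lemma integral_cst_on d (T : measurableType d) (R : realType)
    (mu : {measure set T -> \bar R}) (E : set T) (c : \bar R) (f : T -> \bar R) :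
  measurable E -> (0 <= c)%E -> (forall x, E x -> f x = c) ->
  (forall x, ~ E x -> f x = 0%E) -> (\int[mu]_x f x = mu E * c)%E.
Proof.
move=> mE c0 fE fNE.
rewrite (eq_integral (fun x => (\1_E x)%:E * c)%E); last first.
  move=> x _; rewrite indicE; have [xE|xE] := boolP (x \in E).
    by rewrite mul1e fE//; exact/set_mem.
  by rewrite mul0e fNE//; move/negP: xE => xE /mem_set.
by rewrite ge0_integralZr ?integral_indic ?setIT//; exact: measurableT_comp.
Qed.

(** * Invertible maps and translation invariance *)

Section Haar.
Variables (R : realType) (m : nat).
Variable lam : {sigma_finite_measure set (m.-tuple R) -> \bar R}.
Hypothesis lam_shift : forall v A, measurable A -> lam (shift_tuple v @^-1` A) = lam A.

Lemma measurable_linear_act (A : 'M[R]_m) : measurable_fun setT (linear_act A).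
Proof.
by apply: measurable_col_tuple; apply: measurable_mulmx => i; exact: measurable_tuple_col.
Qed.

(* Integrate [E x * F (x + A y)] over both variables, in both orders. *)
Lemma haar_linear (A : 'M[R]_m) (E F : set (m.-tuple R)) : A \in unitmx ->
  measurable E -> measurable F -> (forall x, E x -> E (col_tuple (- tuple_col x))) ->
  (lam E * lam (linear_act A @^-1` F) = lam F * lam (linear_act A @^-1` E))%E.
Proof.
move=> uA mE mF Esym.
have EsymE x : E (col_tuple (- tuple_col x)) = E x.
  apply/propext; split=> [/Esym|]; last exact: Esym.
  by rewrite col_tupleK opprK tuple_colK.
pose g (s : R) (p : m.-tuple R * m.-tuple R) :=
  col_tuple (tuple_col p.1 + s *: A *m tuple_col p.2).
have mg s : measurable_fun setT (g s).
  apply: measurable_col_tuple; apply: measurable_addmx => i.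
    exact: (measurableT_comp (measurable_tuple_col i) measurable_fst).
  apply: measurable_mulmx => j.
  exact: (measurableT_comp (measurable_tuple_col j) measurable_snd).
pose D := [set p | E p.1 /\ F (g 1 p)].
pose D' := [set p | F p.1 /\ E (g (-1) p)].
have mD : measurable D.
  apply: measurableI; first exact: measurable_preimageT measurable_fst mE.
  exact: measurable_preimageT (mg _) mF.
have mD' : measurable D'.
  apply: measurableI; first exact: measurable_preimageT measurable_fst mF.
  exact: measurable_preimageT (mg _) mE.
have mAF := measurable_preimageT (measurable_linear_act A) mF.
have mAE := measurable_preimageT (measurable_linear_act A) mE.
(* For [x] in [E], the section of [D] is the preimage of [F] under [A], translated by [A^-1 x]. *)
rewrite -(@integral_cst_on _ _ _ lam E _ (fun x => lam [set y | D (x, y)]))//; last 2 first.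
  move=> x Ex; rewrite -(lam_shift (invmx A *m tuple_col x) mAF); congr (lam _).
  apply: funext => y; apply/propext; rewrite /D /g /= scale1r /linear_act /shift_tuple.
  by rewrite col_tupleK mulmxDr mulKVmx//; split=> [[]|].
  by move=> x nEx; rewrite [X in lam X](_ : _ = set0) ?measure0// -subset0 => y [].
(* For [x] in [F], the section of [D'] consists of the [y] with [x - A y] in [E]; by the symmetry of
   [E] it is a translate of the preimage of [E]. *)
rewrite -(@integral_cst_on _ _ _ lam F _ (fun x => lam [set y | D' (x, y)]))//; last 2 first.
  move=> x Fx; rewrite -(lam_shift (- (invmx A *m tuple_col x)) mAE); congr (lam _).
  apply: funext => y; apply/propext; rewrite /D' /g /= /linear_act /shift_tuple.
  rewrite col_tupleK mulmxDr mulmxN mulKVmx// -EsymE col_tupleK opprD scaleN1r mulNmx opprK.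
  by rewrite addrC; split=> [[]|].
  by move=> x nFx; rewrite [X in lam X](_ : _ = set0) ?measure0// -subset0 => y [].
(* With [y] fixed, the translation by [A y] carries the section of [D] onto that of [D']. *)
rewrite !integral_sections_swap//; apply: eq_integral => y _.
have mDy : measurable [set x | D' (x, y)].
  exact: (measurable_preimageT (pair2_measurable y) mD').
rewrite -(lam_shift (A *m tuple_col y) mDy); congr (lam _).
apply: funext => x; apply/propext; rewrite /D /D' /g /= /shift_tuple !col_tupleK.
rewrite scale1r scaleN1r mulNmx (addrC (A *m _)) addrK tuple_colK.
by split=> -[].
Qed.

End Haar.

Lemma measurable_enorm (R : realType) d (T : measurableType d) (m : nat) (f : T -> 'cV[R]_m) :
  (forall i, measurable_fun setT (fun t => f t i ord0)) ->
  measurable_fun setT (fun t => enorm (f t)).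
Proof.
move=> mf; apply: (@measurableT_comp _ _ _ _ _ _ (@Num.sqrt R)).
  by apply: continuous_measurable_fun; exact: sqrt_continuous.
by apply: measurable_sum => i; exact: measurable_funX.
Qed.

Lemma measurable_lt_set (R : realType) d (T : measurableType d) (f g : T -> R) :
  measurable_fun setT f -> measurable_fun setT g -> measurable [set t | f t < g t].
Proof.
move=> mf mg; rewrite (_ : [set t | _] = (fun t => f t < g t) @^-1` [set true]).
  by apply: measurable_preimageT => //; exact: measurable_fun_ltr.
by apply/seteqP; split => t /=.
Qed.

Lemma pmule_inj (R : realType) (a x y : \bar R) :
  a \is a fin_num -> (0 < a)%E -> (a * x = a * y)%E -> x = y.
Proof.
by move=> afin a0 e; apply/eqP; rewrite eq_le; apply/andP; split;
  rewrite -(lee_pmul2l afin a0) e.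
Qed.

(** * Volume of balls and cones under linear maps *)

Section Volume.
Variables (R : realType) (m : nat).
Variable lam : {sigma_finite_measure set (m.-tuple R) -> \bar R}.
Hypothesis lam_shift : forall v A, measurable A -> lam (shift_tuple v @^-1` A) = lam A.
Hypothesis lam_box : forall a, 0 <= a -> lam (box m a) = ((2 * a) ^+ m)%:E.

(** The origin is left out so that every point has a direction; the ball then lies inside the set on
    which symmetric measures are compared. *)
Definition punctured_ball (r : R) : set (m.-tuple R) :=
  [set x | 0 < enorm (tuple_col x) < r].

Lemma measurable_punctured_ball r : measurable (punctured_ball r).
Proof.
rewrite (_ : punctured_ball r = [set x | 0 < enorm (tuple_col x)] `&`
    [set x | enorm (tuple_col x) < r]); last first.
  by apply/seteqP; split => x /= /andP.
by apply: measurableI; apply: measurable_lt_set => //;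
  apply: measurable_enorm => i; exact: measurable_tuple_col.
Qed.

Lemma lam_gt0 (p : 'cV[R]_m) (e : R) (A : set (m.-tuple R)) : 0 < e -> measurable A ->
  (forall x, enorm (tuple_col x - p) < e -> A x) -> (0 < lam A)%E.
Proof.
(* A cube of half-side [e / (m + 1)] about [p] lies in the ball of radius [e], because
   [m < (m + 1)^2]; this includes [m = 0]. *)
move=> e0 mA pA; set a := e / m.+1%:R.
have a0 : 0 < a by rewrite divr_gt0.
have : (0 < lam (shift_tuple (- p) @^-1` box m a))%E.
  rewrite lam_shift ?lam_box ?ltW//; last exact: measurable_box.
  by rewrite lte_fin exprn_gt0// mulr_gt0.
move=> /lt_le_trans; apply; apply: le_measure; rewrite ?inE//.
  exact: (measurable_preimageT (measurable_shift_tuple _) (measurable_box _ _)).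
move=> x xa; apply: pA; apply: (@enorm_lt_of_coord _ _ _ a e); rewrite ?ltW//.
  rewrite exprMn -natr1; set n := m%:R : R.
  have n0 : 0 <= n by exact: ler0n.
  rewrite mulrCA -[ltRHS]mulr1 ltr_pM2l ?exprn_gt0// exprVn ltr_pdivrMr; last first.
    by rewrite exprn_gt0// ltr_wpDl.
  by rewrite mul1r; nra.
by move=> i; have := xa i; rewrite /shift_tuple tnth_mktuple addrC.
Qed.

Lemma lam_punctured_ball_fin r : 0 <= r -> lam (punctured_ball r) \is a fin_num.
Proof.
move=> r0; rewrite ge0_fin_numE//.
apply: (@le_lt_trans _ _ (lam (box m r))); last by rewrite lam_box// ltry.
apply: le_measure; rewrite ?inE.
- exact: measurable_punctured_ball.
- exact: measurable_box.
move=> x /= /andP[_ xr] i; apply: le_lt_trans xr.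
by have := coord_le_enorm (tuple_col x) i; rewrite mxE.
Qed.

Lemma lam_punctured_ball_gt0 r : (0 < m)%N -> 0 < r -> (0 < lam (punctured_ball r))%E.
Proof.
move=> m0 r0; pose e : 'cV[R]_m := delta_mx (Ordinal m0) ord0.
have e0 : e != 0.
  by apply/eqP => /colP/(_ (Ordinal m0)); rewrite !mxE !eqxx => /eqP; rewrite oner_eq0.
(* The point [p] has norm [r / 2], so the ball of radius [r / 4] about it stays away from the origin
   and inside radius [r]. *)
pose p := (r / 2 / enorm e) *: e.
have ep : enorm e != 0 by rewrite enorm_eq0.
have np : enorm p = r / 2.
  by rewrite enormZ ger0_norm ?mulfVK// !divr_ge0 ?enorm_ge0// ltW.
apply: (@lam_gt0 p (r / 4)); first by rewrite divr_gt0.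
  exact: measurable_punctured_ball.
move=> x xp /=; have := enormD (tuple_col x - p) p; rewrite subrK np.
have := enormD (p - tuple_col x) (tuple_col x); rewrite subrK np -enormN opprB.
by move=> h1 h2; apply/andP; split; lra.
Qed.

Lemma punctured_ball_sym r x :
  punctured_ball r x -> punctured_ball r (col_tuple (- tuple_col x)).
Proof. by rewrite /punctured_ball /= col_tupleK enormN. Qed.

(** In [haar_linear] take for [E] the unit ball, which [Q] preserves, and cancel its mass. This
    takes the place of a determinant computation. *)
Lemma lam_orthogonal (Q : 'M[R]_m) A : (0 < m)%N -> Q^T *m Q = 1%:M -> measurable A ->
  lam (linear_act Q @^-1` A) = lam A.
Proof.
move=> m0 QQ mA.
have uQ : Q \in unitmx by have /mulmx1_unit[] := QQ.
have mB := measurable_punctured_ball 1.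
apply: (@pmule_inj _ (lam (punctured_ball 1))).
- exact: lam_punctured_ball_fin.
- exact: lam_punctured_ball_gt0.
rewrite (haar_linear lam_shift uQ mB mA); last exact: punctured_ball_sym.
rewrite muleC; congr (lam _ * _)%E; apply: funext => x.
by rewrite /punctured_ball /= /linear_act col_tupleK enorm_isometry.
Qed.

(** Here [E] is the cube of half-side 1, whose preimage is the cube of half-side [c^-1]. *)
Lemma lam_scale (c : R) A : 0 < c -> measurable A ->
  lam (linear_act (c%:M) @^-1` A) = ((c^-1 ^+ m)%:E * lam A)%E.
Proof.
move=> c0 mA; have uc : (c%:M : 'M[R]_m) \in unitmx.
  by rewrite unitmxE det_scalar unitfE expf_neq0// gt_eqF.
apply: (@pmule_inj _ (lam (box m 1))).
- by rewrite lam_box.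
- by rewrite lam_box// lte_fin exprn_gt0// mulr1.
rewrite (haar_linear lam_shift uc (measurable_box _ _) mA); last first.
  by move=> x x1 i; rewrite tnth_mktuple mxE normrN mxE.
rewrite (_ : linear_act _ @^-1` _ = box m c^-1); last first.
  apply: funext => x; apply/propext; rewrite /box /linear_act /=.
  have E i : (`|tnth [tuple (c%:M *m tuple_col x) j ord0 | j < m] i| < 1) = (`|tnth x i| < c^-1).
    rewrite tnth_mktuple mul_scalar_mx !mxE normrM gtr0_norm//.
    by rewrite -ltr_pdivlMl// mulr1.
  by split=> h i; have := h i; rewrite E.
by rewrite !lam_box ?invr_ge0 ?ltW// muleA -EFinM mulr1 -exprMn muleC.
Qed.

(** Write [B r] for the ball of radius [r]. Apply [haar_linear] to [E = B b] and [F = K] intersected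
    with [B a]. The bounds on [L] give that the preimage of [B b] contains [B 1] and that the
    preimage of [B a] lies in [B 1]; homogeneity of cones produces the powers of [a] and [b]. *)
Lemma linear_act_expansion (L : 'M[R]_m) (a b : R) (K : set (m.-tuple R)) :
  (0 < m)%N -> 0 < a -> 0 < b -> L \in unitmx ->
  (forall v, a * enorm v <= enorm (L *m v) <= b * enorm v) ->
  measurable K -> (forall c x, 0 < c -> K x -> K (linear_act c%:M x)) ->
  (((a / b) ^+ m)%:E * lam (K `&` punctured_ball 1) <=
   lam ((linear_act L @^-1` K) `&` punctured_ball 1))%E.
Proof.
move=> m0 a0 b0 uL Lab mK Kcone.
have mB r := measurable_punctured_ball r.
have mL A (mA : measurable A) := measurable_preimageT (measurable_linear_act L) mA.
have scaleE c A : measurable A -> 0 < c ->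
    (lam (A `&` punctured_ball c) =
     (c ^+ m)%:E * lam (linear_act c%:M @^-1` A `&` punctured_ball 1))%E.
  move=> mA c0; rewrite [in RHS](_ : _ `&` _ = linear_act c%:M @^-1` (A `&` punctured_ball c)).
    rewrite lam_scale//; last exact: measurableI.
    by rewrite muleA -EFinM -exprMn mulfV ?gt_eqF// expr1n mul1e.
  apply: funext => x; apply/propext; rewrite /punctured_ball /= /linear_act col_tupleK.
  rewrite mul_scalar_mx enormZ gtr0_norm// pmulr_rgt0//.
  by rewrite -[X in _ * _ < X]mulr1 ltr_pM2l.
have lt_b x : punctured_ball 1 x -> punctured_ball b (linear_act L x).
  rewrite /punctured_ball /= /linear_act col_tupleK => /andP[x0 x1].
  have /andP[h1 h2] := Lab (tuple_col x); apply/andP; split.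
    by apply: lt_le_trans h1; rewrite mulr_gt0.
  by apply: le_lt_trans h2 _; rewrite -[ltRHS]mulr1 ltr_pM2l.
have lt_a x : punctured_ball a (linear_act L x) -> punctured_ball 1 x.
  rewrite /punctured_ball /= /linear_act col_tupleK => /andP[x0 x1].
  have /andP[h1 h2] := Lab (tuple_col x); apply/andP; split.
    by have := lt_le_trans x0 h2; rewrite pmulr_rgt0.
  by have := le_lt_trans h1 x1; rewrite -[X in _ < X -> _]mulr1 ltr_pM2l.
have Kc c : 0 < c -> linear_act c%:M @^-1` K = K.
  move=> c0; apply: funext => x; apply/propext; split=> [/=|]; last exact: Kcone.
  move=> /(Kcone c^-1); rewrite invr_gt0 => /(_ c0).
  rewrite /linear_act col_tupleK mulmxA -scalar_mxM mulVf ?gt_eqF// mul1mx.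
  by rewrite -/(col_tuple _) tuple_colK.
have bfin : lam (punctured_ball b) \is a fin_num by rewrite lam_punctured_ball_fin ?ltW.
have bp : (0 < lam (punctured_ball b))%E by exact: lam_punctured_ball_gt0.
rewrite -(lee_pmul2l bfin bp).
have E : (lam (punctured_ball b) * lam (linear_act L @^-1` (K `&` punctured_ball a)) =
    lam (K `&` punctured_ball a) * lam (linear_act L @^-1` punctured_ball b))%E.
  apply: haar_linear => //; first exact: measurableI.
  exact: punctured_ball_sym.
apply: (@le_trans _ _
  (lam (punctured_ball b) * lam (linear_act L @^-1` (K `&` punctured_ball a)))%E).
  rewrite E (scaleE a K)// Kc//.
  have -> : lam (punctured_ball b) = ((b ^+ m)%:E * lam (punctured_ball 1))%E.
    by have := @scaleE b setT measurableT b0; rewrite !setTI.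
  rewrite [(_ * lam (punctured_ball 1))%E]muleC -muleA [leRHS]muleC.
  apply: lee_pmul => //.
  - by apply: mule_ge0; [|apply: mule_ge0 => //]; rewrite lee_fin exprn_ge0// ?divr_ge0// ltW.
  - by apply: le_measure; rewrite ?inE//; exact: mL.
  by rewrite muleA -EFinM -exprMn mulrC divfK ?gt_eqF.
rewrite lee_pmul2l//; apply: le_measure; rewrite ?inE.
- by apply: mL; exact: measurableI.
- by apply: measurableI => //; exact: mL.
by move=> x [Kx ax]; split => //; exact: lt_a.
Qed.

End Volume.

(** * Spherically symmetric measures *)

Lemma dot_isometry (R : realType) (m n : nat) (Q : 'M[R]_(m, n)) u v :
  Q^T *m Q = 1%:M -> dot (Q *m u) (Q *m v) = dot u v.
Proof. by move=> QQ; rewrite dot_mulmx mulmxA QQ mul1mx. Qed.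

Lemma measurable_eq_set (R : realType) d (T : measurableType d) (f g : T -> R) :
  measurable_fun setT f -> measurable_fun setT g -> measurable [set t | f t = g t].
Proof.
move=> mf mg; rewrite (_ : [set t | _] = (fun t => f t == g t) @^-1` [set true]).
  by apply: measurable_preimageT => //; exact: measurable_fun_eqr.
by apply/seteqP; split => t /= /eqP.
Qed.

Lemma measurable_dot (R : realType) d (T : measurableType d) (m : nat) (f : T -> 'cV[R]_m) v :
  (forall i, measurable_fun setT (fun t => f t i ord0)) ->
  measurable_fun setT (fun t => dot (f t) v).
Proof.
by move=> mf; apply: measurable_sum => i; exact: measurable_funM.
Qed.

(** A spherically symmetric measure may charge the origin, which has no direction; comparisons of
    directions are restricted to this set. *)
Definition nonzero (R : realType) (m : nat) : set (m.-tuple R) := [set x | tuple_col x != 0].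
Arguments nonzero {R} m.

Lemma nonzeroE (R : realType) m : nonzero m = [set x : m.-tuple R | 0 < enorm (tuple_col x)].
Proof. by apply: funext => x; rewrite /nonzero /= enorm_gt0. Qed.

Lemma measurable_nonzero (R : realType) m : measurable (@nonzero R m).
Proof.
rewrite nonzeroE; apply: measurable_lt_set => //.
by apply: measurable_enorm => i; exact: measurable_tuple_col.
Qed.

(** * Punctured hyperplanes are null sets *)

Section Hyperplane.
Variables (R : realType) (m : nat) (mu : {measure set (m.-tuple R) -> \bar R}).
Hypothesis mu_fin : (mu setT < +oo)%E.
Hypothesis mu_sym : spherically_symmetric mu.

Definition punctured_hyperplane (u : 'cV[R]_m) : set (m.-tuple R) :=
  nonzero m `&` [set x | dot (tuple_col x) u = 0].

Lemma measurable_punctured_hyperplane u : measurable (punctured_hyperplane u).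
Proof.
apply: measurableI; first exact: measurable_nonzero.
apply: measurable_eq_set => //.
by apply: measurable_dot => i; exact: measurable_tuple_col.
Qed.

Lemma mu_punctured_hyperplane u v : u != 0 -> v != 0 ->
  mu (punctured_hyperplane u) = mu (punctured_hyperplane v).
Proof.
move=> u0 v0; have [Q QQ Quv] := orthogonal_align u0 v0.
rewrite -(mu_sym QQ (measurable_punctured_hyperplane v)); congr (mu _).
apply: funext => x; apply/propext.
rewrite /punctured_hyperplane /nonzero /= /linear_act -/(col_tuple _) !col_tupleK.
rewrite -!enorm_gt0 enorm_isometry// !enorm_gt0.
have E : enorm u * dot (Q *m tuple_col x) v = enorm v * dot (tuple_col x) u.
  by rewrite -!dotZr -Quv dot_isometry.
have un : enorm u != 0 by rewrite enorm_eq0.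
have vn : enorm v != 0 by rewrite enorm_eq0.
by split=> -[x0 e]; split=> //; apply/eqP; move: E; rewrite e mulr0 => /eqP;
  rewrite ?[0 == _]eq_sym mulf_eq0 ?(negPf un) ?(negPf vn).
Qed.

(* A nonzero polynomial of size at most [m] vanishes at fewer than [m] points, so
   every nonzero point lies on fewer than [m] of the hyperplanes orthogonal to the
   moment curve. *)
Lemma mu_punctured_hyperplane0 u : u != 0 -> mu (punctured_hyperplane u) = 0%E.
Proof.
move=> u0.
have m0 : (0 < m)%N.
  by case: m u u0 => // u /eqP; case; apply/colP => -[].
pose v (t : nat) : 'cV[R]_m := \col_i t%:R ^+ i.
have v0 t : v t != 0.
  apply/eqP => /colP/(_ (Ordinal m0)); rewrite !mxE/= expr0 => /eqP.
  by rewrite oner_eq0.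
have mH t := measurable_punctured_hyperplane (v t).
have count N x : (\sum_(t <- iota 0 N) \1_(punctured_hyperplane (v t)) x <= m%:R :> R).
  have [x0|x0] := boolP (tuple_col x == 0); last first.
    (* The coordinates of [x] are the coefficients of [p], so [x] is orthogonal to [v t] exactly
       when [t] is a root of [p]. *)
    pose p := rVpoly (tuple_col x)^T.
    have p0 : p != 0.
      apply: contra x0 => /eqP p0; apply/eqP/colP => i; rewrite mxE.
      by have := coef_rVpoly_ord (tuple_col x)^T i; rewrite -/p p0 coef0 !mxE.
    have pE (t : R) : p.[t] = \sum_(i < m) tuple_col x i ord0 * t ^+ i.
      rewrite (@horner_coef_wide _ m); last exact: size_poly.
      by apply: eq_bigr => i _; rewrite coef_rVpoly_ord mxE.
    rewrite (eq_bigr (fun t => ((root p t%:R) : nat)%:R)); last first.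
      move=> t _; rewrite indicE; congr (nat_of_bool _)%:R.
      apply/idP/idP => [/set_mem[_]|] /=.
        rewrite /dot => e; rewrite /root pE -[X in _ == X]e; apply/eqP.
        by apply: eq_bigr => i _; rewrite [v t i _]mxE.
      rewrite /root pE => /eqP e; apply/mem_set; split => //=.
      by rewrite /dot -[RHS]e; apply: eq_bigr => i _; rewrite [v t i _]mxE.
    rewrite -natr_sum ler_nat -big_mkcond/= sum1_count.
    rewrite -size_filter.
    have := @max_poly_roots _ p [seq t%:R | t <- [seq t <- iota 0 N | root p t%:R]] p0.
    rewrite size_map => h; apply: leq_trans (ltnW (h _ _)) (size_poly _ _).
      by apply/allP => r /mapP[t]; rewrite mem_filter => /andP[? _] ->.
    rewrite map_inj_uniq ?filter_uniq ?iota_uniq//.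
    by move=> s t /eqP; rewrite eqr_nat => /eqP.
  rewrite big1 ?ler0n// => t _; rewrite indicE.
  by rewrite memNset// => -[]; rewrite /nonzero /= x0.
(* All these hyperplanes have the same mass. Integrating the count bounds [N] times that mass
   independently of [N], which forces it to be 0. *)
have bound N : (N%:R%:E * mu (punctured_hyperplane u) <= m%:R%:E * mu setT)%E.
  have -> : (N%:R%:E * mu (punctured_hyperplane u) =
      \sum_(t <- iota 0 N) mu (punctured_hyperplane (v t)))%E.
    rewrite (eq_bigr (fun=> mu (punctured_hyperplane u))); last first.
      by move=> t _; exact: mu_punctured_hyperplane.
    by rewrite big_const_seq count_predT size_iota iter_addr addr0 mule_natl.
  rewrite (eq_bigr (fun t => \int[mu]_x (\1_(punctured_hyperplane (v t)) x)%:E)%E); last first.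
    by move=> t _; rewrite integral_indic ?setIT.
  rewrite -ge0_integral_sum//; last by move=> t; exact/measurable_EFinP/measurable_indic.
  rewrite -integral_cst//; apply: ge0_le_integral => //.
  - by move=> x _; rewrite sume_ge0.
  - by apply: emeasurable_sum => t; exact/measurable_EFinP/measurable_indic.
  - by move=> x _; rewrite sumEFin lee_fin.
have Tfin : mu setT \is a fin_num by rewrite ge0_fin_numE.
have Hfin : mu (punctured_hyperplane u) \is a fin_num.
  rewrite ge0_fin_numE//; apply: le_lt_trans mu_fin; apply: le_measure; rewrite ?inE//.
  exact: measurable_punctured_hyperplane.
apply/eqP; rewrite eq_le measure_ge0 andbT leNgt; apply/negP => Hp.
move: bound; rewrite -(fineK Hfin) -(fineK Tfin) => bound.
set r := fine (mu (punctured_hyperplane u)) in bound.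
have r0 : 0 < r by rewrite -lte_fin fineK.
set c := m%:R * fine (mu setT) / r.
have := bound (Num.bound c); rewrite -!EFinM lee_fin -ler_pdivlMr// -/c leNgt.
by rewrite archi_boundP// divr_ge0 ?mulr_ge0 ?ler0n ?fine_ge0// ltW.
Qed.

End Hyperplane.

(** * Angular neighbourhoods of a direction *)

Section Directions.
Variables (R : realType) (m : nat).
Implicit Types u v : 'cV[R]_m.

(** For nonzero vectors this says that the normalised vectors are at distance less than [e]. With
    denominators cleared, the zero vector is near nothing. *)
Definition dirnear (e : R) u v : bool :=
  enorm (enorm u *: v - enorm v *: u) < e * (enorm u * enorm v).

Lemma dirnear_sym e u v : dirnear e u v = dirnear e v u.
Proof. by rewrite /dirnear -enormN opprB (mulrC (enorm u)). Qed.

Lemma dirnear_neq0 e u v : dirnear e u v -> u != 0.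
Proof.
apply: contraTN => /eqP ->; rewrite /dirnear enorm0 scaler0 scale0r subrr enorm0.
by rewrite mul0r mulr0 ltxx.
Qed.

Lemma dirnear_scale e c u v : 0 < c -> dirnear e (c *: u) v = dirnear e u v.
Proof.
move=> c0; rewrite /dirnear enormZ gtr0_norm// scalerA [_ * c]mulrC -!scalerA.
by rewrite -scalerBr enormZ gtr0_norm// -mulrA [e * _]mulrCA ltr_pM2l.
Qed.

Lemma dirnear_isometry e (Q : 'M[R]_m) u v : Q^T *m Q = 1%:M ->
  dirnear e (Q *m u) (Q *m v) = dirnear e u v.
Proof.
by move=> QQ; rewrite /dirnear !enorm_isometry// !scalemxAr -mulmxBr enorm_isometry.
Qed.

Lemma dirnear_dist e u v : dirnear e u v ->
  enorm ((enorm u / enorm v) *: v - u) < e * enorm u.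
Proof.
move=> uv; have v0 : 0 < enorm v.
  by rewrite enorm_gt0; move: uv; rewrite dirnear_sym => /dirnear_neq0.
rewrite -(ltr_pM2l v0) -{1}[enorm v]gtr0_norm// -enormZ scalerBr scalerA.
rewrite mulrCA mulfV ?gt_eqF// mulr1; apply: lt_le_trans uv _.
by rewrite [leRHS]mulrCA [enorm v * _]mulrC.
Qed.

(** The left side of [dirnear] is at most twice the distance of [v] from [u / 2], hence below
    [e / 4], while [|v| > 3 / 8]. So a direction cone contains a Euclidean ball and has positive
    volume. *)
Lemma dirnear_half e u v : enorm u = 1 -> 0 < e -> e <= 1 ->
  enorm (v - 2^-1 *: u) < e / 8 -> dirnear e u v.
Proof.
move=> u1 e0 e1 vu; rewrite /dirnear u1 scale1r mul1r.
have h1 := enormD (v - 2^-1 *: u) (2^-1 *: u).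
have h2 := enormD (2^-1 *: u - v) v.
rewrite subrK enormZ u1 mulr1 ger0_norm ?invr_ge0// in h1.
rewrite subrK enormZ u1 mulr1 ger0_norm ?invr_ge0// in h2.
rewrite -[enorm (_ - v)]enormN opprB in h2.
have h3 := enormD (v - 2^-1 *: u) ((2^-1 - enorm v) *: u).
rewrite enormZ u1 mulr1 scalerBl addrA subrK in h3.
have h4 : `|2^-1 - enorm v| <= enorm (v - 2^-1 *: u) by rewrite ler_norml; apply/andP; split; lra.
nra.
Qed.

Definition dircone (e : R) u : set (m.-tuple R) := [set y | dirnear e u (tuple_col y)].

Lemma measurable_dirnear d (T : measurableType d) e (f g : T -> 'cV[R]_m) :
  (forall i, measurable_fun setT (fun t => f t i ord0)) ->
  (forall i, measurable_fun setT (fun t => g t i ord0)) ->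
  measurable [set t | dirnear e (f t) (g t)].
Proof.
move=> mf mg; have mfe := measurable_enorm mf; have mge := measurable_enorm mg.
apply: measurable_lt_set.
  apply: measurable_enorm; apply: measurable_addmx => i.
    by under eq_fun do rewrite mxE; exact: measurable_funM.
  under eq_fun do rewrite !mxE.
  by apply: measurableT_comp => //; exact: measurable_funM.
by apply: measurable_funM => //; exact: measurable_funM.
Qed.

Lemma measurable_dircone e u : measurable (dircone e u).
Proof.
by apply: measurable_dirnear => i; [exact: measurable_cst|exact: measurable_tuple_col].
Qed.

(** This is the uniform distribution that Christensen's argument requires: the mass of a cone
    depends on its aperture only. *)
Lemma dircone_const (mu : set (m.-tuple R) -> \bar R) e u v :
  spherically_symmetric mu -> u != 0 -> v != 0 -> mu (dircone e u) = mu (dircone e v).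
Proof.
move=> mu_sym u0 v0; have [Q QQ Quv] := orthogonal_align u0 v0.
rewrite -(mu_sym Q QQ _ (measurable_dircone e v)); congr (mu _); apply: funext => y.
rewrite /dircone /= /linear_act -/(col_tuple _) col_tupleK.
have un : 0 < enorm u by rewrite enorm_gt0.
have vn : 0 < enorm v by rewrite enorm_gt0.
by rewrite -(dirnear_scale e v _ un) -Quv dirnear_isometry// dirnear_scale.
Qed.

End Directions.

(** * Comparison of symmetric measures on open cones *)

Section Christensen.
Variables (R : realType) (m : nat).
Variables (mu lam : {finite_measure set (m.-tuple R) -> \bar R}).
Hypothesis mu_sym : spherically_symmetric mu.
Hypothesis lam_sym : spherically_symmetric lam.
Hypothesis lam_dircone : forall e u, 0 < e -> u != 0 -> (0 < lam (dircone e u))%E.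
Local Open Scope ereal_scope.

(* Christensen's argument: two measures giving to all balls of a given radius the
   same mass are proportional on open sets. *)
Lemma symmetric_cone_le (U : set (m.-tuple R)) : measurable U ->
  (forall x, U x -> nonzero m x -> exists2 e : R, (0 < e)%R &
     forall y, dirnear e (tuple_col x) (tuple_col y) -> U y) ->
  mu (nonzero m) * lam (U `&` nonzero m) <= mu (U `&` nonzero m) * lam (nonzero m).
Proof.
move=> mU Uopen.
have mN := @measurable_nonzero R m.
have mUN : measurable (U `&` nonzero m) by exact: measurableI.
have [->|/set0P[x0 x0n]] := eqVneq (@nonzero R m) set0.
  by rewrite setI0 !measure0 !mule0.
have [mu0|mu0] := eqVneq (mu (nonzero m)) 0.
  by rewrite mu0 mul0e mule_ge0.
have mup : 0 < mu (nonzero m) by rewrite lt_def mu0 measure_ge0.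
have fmu A : measurable A -> mu A \is a fin_num by exact: fin_num_measure.
have flam A : measurable A -> lam A \is a fin_num by exact: fin_num_measure.
pose e (n : nat) : R := (n.+1%:R^-1)%R.
have e0 n : (0 < e n)%R by rewrite invr_gt0.
pose u0 := tuple_col x0.
pose M n := mu (dircone (e n) u0).
pose G n := lam (dircone (e n) u0).
have ME n u : u != 0%R -> mu (dircone (e n) u) = M n by move=> un; exact: dircone_const.
have GE n u : u != 0%R -> lam (dircone (e n) u) = G n by move=> un; exact: dircone_const.
pose N n := [set p : m.-tuple R * m.-tuple R | dirnear (e n) (tuple_col p.1) (tuple_col p.2)].
have mNn n : measurable (N n).
  apply: measurable_dirnear => i.
    exact: (measurableT_comp (measurable_tuple_col i) measurable_fst).
  exact: (measurableT_comp (measurable_tuple_col i) measurable_snd).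
(* The pairs of directions closer than [e n] are measured in both orders of integration. *)
have GM n : mu (nonzero m) * G n = lam (nonzero m) * M n.
  rewrite -(@integral_cst_on _ _ _ mu _ _ (fun x => lam [set y | N n (x, y)]))//; last 2 first.
    by move=> x xn; exact: (GE n (tuple_col x) xn).
    move=> x xn; rewrite (_ : [set y | _] = set0) ?measure0// -subset0 => y.
    by rewrite /N /= => /dirnear_neq0.
  rewrite -(@integral_cst_on _ _ _ lam _ _ (fun y => mu [set x | N n (x, y)]))//; last 2 first.
    move=> y yn; rewrite -(ME n _ yn); congr (mu _); apply: funext => x.
    by rewrite /N /dircone /= dirnear_sym.
    move=> y yn; rewrite (_ : [set x | _] = set0) ?measure0// -subset0 => x.
    by rewrite /N /= dirnear_sym => /dirnear_neq0.
  exact: integral_sections_swap.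
have Gp n : 0 < G n by exact: lam_dircone.
have Mp n : 0 < M n.
  rewrite lt_def measure_ge0 andbT; apply/eqP => M0.
  have := GM n; rewrite M0 mule0 => /eqP; rewrite mule_eq0 (negPf mu0)/=.
  by rewrite gt_eqF.
have mM n : measurable (dircone (e n) u0) by exact: measurable_dircone.
have Mfin n : M n \is a fin_num by exact: fmu.
pose D n := [set p : m.-tuple R * m.-tuple R | [/\ U p.1, U p.2 & N n p]].
have mD n : measurable (D n).
  rewrite (_ : D n = (fst @^-1` U) `&` (snd @^-1` U) `&` N n); last first.
    by apply: funext => p; apply/propext; split=> [[]|[[]]].
  apply: measurableI => //; apply: measurableI.
    exact: measurable_preimageT measurable_fst mU.
  exact: measurable_preimageT measurable_snd mU.
have mDf n := measurable_fun_sections2 mu (mD n).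
(* For nonzero [y] in [U], this is the proportion of the [mu]-mass of the cone around [y] that lies
   in [U]; as [U] is open, it is eventually 1. *)
pose f n y := ((fine (M n))^-1)%:E * mu [set x | D n (x, y)].
have f0 n y : 0 <= f n y.
  by rewrite mule_ge0// lee_fin invr_ge0 fine_ge0.
have mf n : measurable_fun (U `&` nonzero m) (f n).
  by apply: measurable_funTS; apply: measurable_funeM; exact: mDf.
have flim y : (U `&` nonzero m) y -> limn_einf (f ^~ y) = 1.
  move=> [Uy yn]; have [r r0 Ur] := Uopen y Uy yn.
  apply: (cvg_limn_einf_sup _).1; apply: cvg_near_cst.
  have := near_infty_natSinv_lt (PosNum r0); apply: filterS => n nr.
  rewrite /f (_ : [set x | _] = dircone (e n) (tuple_col y)).
    rewrite ME// -[X in _ * X](fineK (Mfin n)) -EFinM mulVf// gt_eqF//.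
    by rewrite fine_gt0// Mp/= ltey_eq Mfin.
  apply: funext => x; apply/propext; rewrite /D /N /dircone /= dirnear_sym.
  split=> [[]//|xy]; split=> //; apply: Ur.
  by apply: lt_le_trans xy _; rewrite ler_wpM2r ?mulr_ge0 ?enorm_ge0// ltW.
(* After exchanging the integrals, each [x] in [U] contributes at most [G n], and [GM] turns
   [G n / M n] into a ratio of total masses free of [n]. *)
have fint n : \int[lam]_(y in U `&` nonzero m) f n y <=
    mu (U `&` nonzero m) * lam (nonzero m) * ((fine (mu (nonzero m)))^-1)%:E.
  apply: (@le_trans _ _ (((fine (M n))^-1)%:E * (mu (U `&` nonzero m) * G n))).
    rewrite ge0_integralZl//; last 2 first.
      by apply: measurable_funTS; exact: mDf.
      by rewrite lee_fin invr_ge0 fine_ge0.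
    apply: lee_wpmul2l; first by rewrite lee_fin invr_ge0 fine_ge0.
    apply: (@le_trans _ _ (\int[lam]_y mu [set x | D n (x, y)])).
      by apply: ge0_subset_integral => //; exact: mDf.
    rewrite -integral_sections_swap//.
    pose g x := (\1_(U `&` nonzero m) x)%:E * G n.
    rewrite -(@integral_cst_on _ _ _ mu _ _ g)//; last 2 first.
      by move=> x Ux; rewrite /g indicE mem_set// mul1e.
      by move=> x Ux; rewrite /g indicE memNset// mul0e.
    apply: ge0_le_integral => //.
    - exact: (measurable_fun_sections1 lam (mD n)).
    - rewrite /g; under eq_fun do rewrite muleC.
      by apply: measurable_funeM; exact/measurable_EFinP/measurable_indic.
    move=> x _; rewrite /g indicE; have [xU|xU] := boolP (x \in _).
      have [Ux xn] := set_mem xU; rewrite mul1e -(GE n _ xn); apply: le_measure; rewrite ?inE.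
      - exact: (measurable_preimageT (pair1_measurable x) (mD n)).
      - exact: measurable_dircone.
      by move=> y [].
    rewrite mul0e (_ : [set y | _] = set0) ?measure0// -subset0 => y [Ux _ /dirnear_neq0 xn].
    by move/negP: xU; apply; exact/mem_set.
  have := GM n; have := Mp n; have := Mfin n; have := mup; have := fmu _ mN.
  have := fmu _ mUN; have := flam _ mN; have := flam _ (mM n); rewrite -/(G n).
  move=> /fineK <- /fineK <- /fineK <- /fineK <- + /fineK <-.
  rewrite -!EFinM !lte_fin lee_fin /=; set c := fine _; set M' := fine (M n).
  move=> c0 M0 [cG]; rewrite le_eqVlt; apply/orP; left; apply/eqP.
  have -> : (fine (G n) = fine (lam (nonzero m)) * M' / c)%R.
    by rewrite -cG mulrAC mulfV ?mul1r// gt_eqF.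
  by field; rewrite !gt_eqF.
(* Fatou's lemma carries the bound, uniform in [n], over to the limit 1 of the proportions. *)
have := fatou lam mUN mf (fun n y _ => f0 n y).
rewrite (eq_integral (cst 1)); last by move=> y /set_mem; exact: flim.
rewrite integral_cst// mul1e => /le_trans h.
have {}h : lam (U `&` nonzero m) <=
    mu (U `&` nonzero m) * lam (nonzero m) * ((fine (mu (nonzero m)))^-1)%:E.
  apply: h; rewrite limn_einf_lim; apply: lime_le.
    exact: is_cvg_einfs.
  apply: nearW => n; apply: le_trans (fint n).
  by apply: ereal_inf_lbound; exists n => /=.
move: h mup; have := fmu _ mN; have := fmu _ mUN; have := flam _ mN.
have := flam _ mUN; move=> /fineK <- /fineK <- /fineK <- /fineK <-.
by rewrite -!EFinM lte_fin !lee_fin => h c0; rewrite mulrC -ler_pdivlMr.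
Qed.

End Christensen.

(** * The cone of increasing vectors *)

(** The value [s i] is entry [i] of the list of indices sorted by [f]; injectivity makes the order
    strict. *)
Lemma exists_sorting_perm disp (T : orderType disp) (k : nat) (f : 'I_k -> T) :
  injective f -> exists s : 'S_k, forall i j : 'I_k, (i < j)%N -> (f (s i) < f (s j))%O.
Proof.
move=> finj; pose leT i j := (f i <= f j)%O.
pose l := sort leT (enum 'I_k).
have szl : size l = k by rewrite size_sort size_enum_ord.
have ul : uniq l by rewrite sort_uniq enum_uniq.
have sl : sorted leT l by apply: sort_sorted => i j; exact: le_total.
have ginj : injective (fun i : 'I_k => nth i l i).
  move=> i j; rewrite (set_nth_default i j) ?szl// => /eqP.
  by rewrite nth_uniq ?szl// => /eqP /val_inj.
exists (perm ginj) => i j ij; rewrite !permE lt_neqAle; apply/andP; split.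
  by apply: contraTneq ij => /finj /ginj ->; rewrite ltnn.
have le_tr : transitive leT by move=> a b c; exact: le_trans.
rewrite (set_nth_default i j) ?szl//.
by apply: (sorted_leq_nth le_tr _ i sl); rewrite ?inE ?szl ?(ltnW ij)// => a; exact: lexx.
Qed.

Lemma sorted_map_tuple (I : Type) (k : nat) (y : k.-tuple I) (f : I -> nat) :
  (forall i j : 'I_k, (i < j)%N -> (f (tnth y i) < f (tnth y j))%N) ->
  sorted ltn [seq f i | i <- y].
Proof.
move=> fy; apply/(sortedP 0) => i; rewrite size_map size_tuple => ik.
have := fy (Ordinal (ltnW ik)) (Ordinal ik) (ltnSn i).
have y0 := tnth y (Ordinal ik).
by rewrite !(tnth_nth y0) /= !(nth_map y0) ?size_tuple// ltnW.
Qed.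

(** Fixing every index outside [y] completes the permuted tuple to a bijection. *)
Lemma perm_extending (n k : nat) (y : k.-tuple 'I_n) (tau : 'S_k) : uniq y ->
  exists rho : 'S_n, forall i, rho (tnth y i) = tnth y (tau i).
Proof.
move=> uy; have yinj : injective (tnth y) by apply/tuple_uniqP.
pose g z := if [pick i | tnth y i == z] is Some i then tnth y (tau i) else z.
have gy i : g (tnth y i) = tnth y (tau i).
  rewrite /g; case: pickP => [j /eqP /yinj ->//|/(_ i)].
  by rewrite eqxx.
have gn z : z \notin y -> g z = z.
  by rewrite /g; case: pickP => // i /eqP <-; rewrite mem_tnth.
have ginj : injective g.
  move=> a b; have [/tnthP[i ->]|an] := boolP (a \in y);
    have [/tnthP[j ->]|bn] := boolP (b \in y).
  - by rewrite !gy => /yinj /perm_inj ->.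
  - by rewrite gy gn// => e; move: bn; rewrite -e mem_tnth.
  - by rewrite gy gn// => e; move: an; rewrite e mem_tnth.
  - by rewrite !gn.
by exists (perm ginj) => i; rewrite permE gy.
Qed.

(** Double counting of pairs [(s, tau)] such that [rho tau * s] sorts [y]: each [s] has at least one
    such [tau], and for each [tau] multiplication by [rho tau] is a bijection, so it has as many [s]
    as there are sorting permutations. *)
Lemma card_sorted_perm (n k : nat) (y : k.-tuple 'I_n) : uniq y ->
  (n`! <= k`! * #|[pred s : 'S_n | sorted ltn [seq nat_of_ord (s i) | i <- y]]|)%N.
Proof.
move=> uy; set A := [pred s | _].
have yinj : injective (tnth y) by apply/tuple_uniqP.
have [rho rhoE] := choice (fun tau : 'S_k => perm_extending tau uy).
rewrite -card_Sn -sum1_card -[k`!]card_Sn -sum_nat_const.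
apply: (@leq_trans (\sum_(s in 'S_n) \sum_(tau in 'S_k) ((rho tau * s)%g \in A))).
  apply: leq_sum => s _.
  have finj : injective (fun i => nat_of_ord (s (tnth y i))).
    by move=> i j /val_inj /perm_inj /yinj.
  have [tau tauE] := exists_sorting_perm finj.
  rewrite (bigD1 tau)//= ltn_addr// lt0b inE sorted_map_tuple// => i j ij.
  by rewrite !permM !rhoE; exact: tauE.
rewrite exchange_big/=; apply: leq_sum => tau _.
rewrite -sum1_card [leqRHS]big_mkcond/= [leqRHS](reindex_inj (mulgI (rho tau)))/=.
by apply: leq_sum => s _; case: ifP.
Qed.

Lemma measure_bigsetU_le d (T : measurableType d) (R : realType)
    (mu : {measure set T -> \bar R}) (I : Type) (s : seq I) (A : I -> set T) :
  (forall i, measurable (A i)) ->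
  (mu (\big[setU/set0]_(i <- s) A i) <= \sum_(i <- s) mu (A i))%E.
Proof.
move=> mA; elim: s => [|i s IH]; first by rewrite !big_nil measure0.
rewrite !big_cons; apply: le_trans (measureU2 _ _ _) _ => //.
  by apply: bigsetU_measurable.
by rewrite leeD2l.
Qed.

Section Increasing.
Variables (R : realType) (k : nat).

Definition increasing (v : 'cV[R]_k) : Prop :=
  forall i j : 'I_k, (i < j)%N -> v i ord0 < v j ord0.

Definition increasing_cone : set (k.-tuple R) := [set x | increasing (tuple_col x)].

Lemma measurable_increasing d (T : measurableType d) (f : T -> 'cV[R]_k) :
  (forall i, measurable_fun setT (fun t => f t i ord0)) ->
  measurable [set t | increasing (f t)].
Proof.
move=> mf; pose A (p : 'I_k * 'I_k) :=
  if (p.1 < p.2)%N then [set t | f t p.1 ord0 < f t p.2 ord0] else setT.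
rewrite (_ : [set t | _] = \bigcap_(p in [set: 'I_k * 'I_k]) A p); last first.
  apply/seteqP; split=> t /= h.
    by move=> [i j] _; rewrite /A /=; case: ifP => // /h.
  by move=> i j ij; have := h (i, j) I; rewrite /A /= ij.
apply: fin_bigcap_measurable => // p _; rewrite /A; case: ifP => // _.
exact: measurable_lt_set.
Qed.

Lemma measurable_increasing_cone : measurable increasing_cone.
Proof. by apply: measurable_increasing => i; exact: measurable_tuple_col. Qed.

Lemma increasing_scale c v : 0 < c -> increasing v -> increasing (c *: v).
Proof. by move=> c0 vi i j /vi ij; rewrite !mxE ltr_pM2l. Qed.

Lemma increasing_open (L : 'M[R]_k) (b : R) (x : k.-tuple R) : 0 < b ->
  (forall v, enorm (L *m v) <= b * enorm v) ->
  increasing (L *m tuple_col x) -> nonzero k x -> exists2 e : R, 0 < e &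
     forall y : k.-tuple R, dirnear e (tuple_col x) (tuple_col y) -> increasing (L *m tuple_col y).
Proof.
move=> b0 Lb; rewrite /nonzero /=; set u := tuple_col x => Lu u0.
pose z := L *m u.
(* The smallest gap between coordinates of [L u]; the value 1 covers the case of no pairs. *)
pose eta := \big[Num.min/1]_(p : 'I_k * 'I_k | (p.1 < p.2)%N) (z p.2 ord0 - z p.1 ord0).
have eta0 : 0 < eta by apply: lt_bigmin => // p ij; rewrite subr_gt0; exact: Lu.
have etaE (i j : 'I_k) : (i < j)%N -> eta <= z j ord0 - z i ord0.
  by move=> ij; have := @bigmin_le_cond _ _ _ 1 (i, j) (fun p => (p.1 < p.2)%N)
    (fun p => z p.2 ord0 - z p.1 ord0) ij.
have un : 0 < enorm u by rewrite enorm_gt0.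
(* With this aperture, once [y] is rescaled to the norm of [u], its image differs from [L u] by less
   than [eta / 2] in each coordinate, so no order is reversed. *)
exists (eta / (2 * b * enorm u)); first by rewrite divr_gt0// !mulr_gt0.
move=> y; set v := tuple_col y => uv.
have v0 : 0 < enorm v.
  by rewrite enorm_gt0; move: uv; rewrite dirnear_sym => /dirnear_neq0.
have := dirnear_dist uv; set c := enorm u / enorm v => h.
have c0 : 0 < c by rewrite divr_gt0.
suff : increasing (L *m (c *: v)).
  move=> /(increasing_scale (_ : 0 < c^-1)); rewrite invr_gt0 => /(_ c0).
  by rewrite -scalemxAr scalerA mulVf ?scale1r// gt_eqF.
have h2 : enorm (L *m (c *: v) - z) < eta / 2.
  rewrite /z -mulmxBr; apply: le_lt_trans (Lb _) _.
  rewrite -ltr_pdivlMl//; apply: lt_le_trans h _; rewrite le_eqVlt; apply/orP; left.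
  by apply/eqP; field; rewrite !gt_eqF.
move=> i j ij; have := etaE i j ij.
have := coord_le_enorm (L *m (c *: v) - z) i.
have := coord_le_enorm (L *m (c *: v) - z) j.
rewrite ![(_ - z) _ _]mxE ![(- z) _ _]mxE; set p := L *m (c *: v).
rewrite !ler_norml => /andP[h3 h4] /andP[h5 h6] h7.
lra.
Qed.

(** The images of the cone under the [k!] coordinate permutations have equal mass and cover the
    vectors with distinct coordinates. All other nonzero vectors lie on null hyperplanes where two
    coordinates agree. *)
Lemma increasing_cone_measure (nu : {measure set (k.-tuple R) -> \bar R}) :
  (nu setT < +oo)%E -> spherically_symmetric nu ->
  (nu (nonzero k) <= k`!%:R%:E * nu (increasing_cone `&` nonzero k))%E.
Proof.
move=> nu_fin nu_sym.
have mC := measurable_increasing_cone.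
have mN := @measurable_nonzero R k.
have mCN : measurable (increasing_cone `&` nonzero k) by exact: measurableI.
pose A (s : 'S_k) := linear_act (perm_mx s) @^-1` (increasing_cone `&` nonzero k).
have sorth (s : 'S_k) : (perm_mx s)^T *m perm_mx s = 1%:M :> 'M[R]_k.
  by rewrite tr_perm_mx -perm_mxM mulVg perm_mx1.
have mA s : measurable (A s).
  exact: (measurable_preimageT (measurable_linear_act _) mCN).
pose e (p : 'I_k * 'I_k) : 'cV[R]_k := delta_mx p.1 ord0 - delta_mx p.2 ord0.
(* Diagonal pairs get the empty set, since their normal vector is 0. *)
pose H (p : 'I_k * 'I_k) := if p.1 == p.2 then set0 else punctured_hyperplane (e p).
have mH p : measurable (H p).
  by rewrite /H; case: ifP => // _; exact: measurable_punctured_hyperplane.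
have H0 p : nu (H p) = 0%E.
  rewrite /H; case: ifPn => [_|p12]; first exact: measure0.
  apply: mu_punctured_hyperplane0 => //; apply/eqP => /colP/(_ p.1).
  by rewrite !mxE !eqxx (negPf p12)/= subr0 => /eqP; rewrite oner_eq0.
have dotd v (i : 'I_k) : dot v (delta_mx i ord0) = v i ord0.
  rewrite /dot (bigD1 i)//= big1 => [|j ji]; last by rewrite mxE (negPf ji) mulr0.
  by rewrite mxE !eqxx mulr1 addr0.
have cover : nonzero k `<=` \big[setU/set0]_(s : 'S_k) A s `|` \big[setU/set0]_p H p.
  move=> x xn; have [xinj|] := pselect (injective (fun i => tuple_col x i ord0)).
    left; have [s sE] := exists_sorting_perm xinj.
    rewrite -bigcup_seq; exists s => /=; first by rewrite mem_index_enum.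
    rewrite /A /linear_act /nonzero /increasing_cone -/(col_tuple _) /= col_tupleK; split.
      by move=> i j ij; rewrite -!row_permE !mxE; have := sE i j ij; rewrite !mxE.
    by rewrite -enorm_gt0 enorm_isometry// enorm_gt0.
  move=> ninj; right; apply: contrapT => nH; apply: ninj => i j ij; apply: contrapT => nij.
  apply: nH; rewrite -bigcup_seq; exists (i, j) => /=; first by rewrite mem_index_enum.
  rewrite /H /=; case: eqP => // _; split => //=.
  by rewrite /e dotDr dotNr !dotd ij subrr.
apply: (@le_trans _ _ (nu (\big[setU/set0]_(s : 'S_k) A s `|` \big[setU/set0]_p H p))).
  apply: le_measure; rewrite ?inE//; apply: measurableU; exact: bigsetU_measurable.
apply: le_trans (measureU2 _ _ _) _; try exact: bigsetU_measurable.
rewrite -[leRHS]adde0; apply: leeD.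
  apply: le_trans (measure_bigsetU_le _ _ _) _ => //.
  rewrite (eq_bigr (fun=> nu (increasing_cone `&` nonzero k))) => [|s _]; last first.
    exact: nu_sym.
  by rewrite sumr_const card_Sn mule_natl.
apply: le_trans (measure_bigsetU_le _ _ _) _ => //.
by rewrite big1.
Qed.

End Increasing.

(** * Restricted isometries and projections *)

Lemma bernoulli_ineq (R : realType) (e : R) (k : nat) : 0 <= e <= 1 ->
  1 - k%:R * e <= (1 - e) ^+ k.
Proof.
move=> /andP[e0 e1]; elim: k => [|k IH]; first by rewrite mul0r subr0 expr0.
rewrite exprS -natr1; have k0 : 0 <= k%:R :> R by exact: ler0n.
apply: le_trans (ler_wpM2l _ IH); last by rewrite subr_ge0.
nra.
Qed.

(** Passes from a set of columns, listed by [enum_val], to a duplicate-free tuple in any order: the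
    norm and the matrix product are sums that do not depend on the listing. *)
Lemma restricted_isometry_tuple (R : realType) (d n k : nat) (e : R) (X : 'M[R]_(d, n))
    (y : k.-tuple 'I_n) : restricted_isometry k e X -> uniq y -> forall v : 'cV_k,
  (1 - e) * sqnorm v <= sqnorm (colsub (tnth y) X *m v) <= (1 + e) * sqnorm v.
Proof.
move=> hX uy v; have yinj : injective (tnth y) by apply/tuple_uniqP.
pose S : {set 'I_n} := (tnth y) @: [set: 'I_k]%SET.
have cS : #|S| = k by rewrite card_imset// cardsT card_ord.
pose g z := \sum_(i < k | tnth y i == z) v i ord0.
have gy i : g (tnth y i) = v i ord0.
  by rewrite /g (big_pred1 i)// => j /=; rewrite (inj_eq yinj).
have sumS (F : 'I_n -> R) : \sum_(j < #|S|) F (enum_val j) = \sum_(i < k) F (tnth y i).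
  rewrite -(big_enum_val (A := mem S)) big_imset/=; last by move=> ? ? _ _; exact: yinj.
  by apply: eq_bigl => i; rewrite finset.in_setT.
have := hX S (eq_leq cS) (\col_j g (enum_val j)).
have -> : sqnorm (\col_(j < #|S|) g (enum_val j)) = sqnorm v.
  rewrite /sqnorm; under eq_bigr do rewrite mxE.
  rewrite (sumS (fun z => g z ^+ 2)).
  by apply: eq_bigr => i _; rewrite gy.
suff -> : colsub (fun j : 'I_#|S| => enum_val j) X *m \col_j g (enum_val j) =
  colsub (tnth y) X *m v by [].
apply/colP => r; rewrite !mxE; under eq_bigr do rewrite !mxE.
rewrite (sumS (fun z => X r z * g z)).
by apply: eq_bigr => i _; rewrite gy mxE.
Qed.

(** The random permutation is known to be measurable fibre by fibre, so its events are assembled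
    from finitely many fibres. *)
Lemma measurable_fiber_seq d (T : measurableType d) (I : eqType) (f : T -> I)
    (E : set T) (s : seq I) :
  measurable E -> (forall i, measurable [set t | f t = i]) ->
  measurable [set t | E t /\ f t \in s].
Proof.
move=> mE mf; elim: s => [|i s IH].
  by rewrite (_ : [set t | _] = set0)// -subset0 => t [].
rewrite (_ : [set t | _] = E `&` [set t | f t = i] `|` [set t | E t /\ f t \in s]).
  by apply: measurableU => //; exact: measurableI.
apply/seteqP; split=> t /=.
  by rewrite inE => -[Et /orP[/eqP|]]; [left|right].
by rewrite inE => -[[Et ->]|[Et ->]]; rewrite ?eqxx ?orbT.
Qed.

Lemma measure_fiber_seq d (T : measurableType d) (R : realType)
    (mu : {measure set T -> \bar R}) (I : eqType) (f : T -> I) (E : set T) (s : seq I) :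
  measurable E -> (forall i, measurable [set t | f t = i]) -> uniq s ->
  mu [set t | E t /\ f t \in s] = (\sum_(i <- s) mu [set t | E t /\ f t = i])%E.
Proof.
move=> mE mf; elim: s => [_|i s IH /= /andP[i_s us]].
  by rewrite big_nil (_ : [set t | _] = set0) ?measure0// -subset0 => t [].
rewrite big_cons -IH// -measureU//.
- congr (mu _); apply/seteqP; split=> t /=.
    by rewrite inE => -[Et /orP[/eqP|]]; [left|right].
  by rewrite inE => -[[Et ->]|[Et ->]]; rewrite ?eqxx ?orbT.
- exact: (measurableI _ _ mE (mf i)).
- exact: measurable_fiber_seq.
by rewrite -subset0 => t [/= [_ fi] [_]]; rewrite fi (negPf i_s).
Qed.

(** * Projection of a symmetric law to a subspace *)

Section Projection.
Context disp (T : measurableType disp) (R : realType) (P : probability T R).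
Variables (d k : nat) (w : {RV P >-> d.-tuple R}) (U : 'M[R]_(d, k)).
Hypothesis UU : U^T *m U = 1%:M.
Hypothesis hw : spherically_symmetric (distribution P w).

Definition project (x : d.-tuple R) : k.-tuple R := col_tuple (U^T *m tuple_col x).

Lemma measurable_project : measurable_fun setT project.
Proof.
by apply: measurable_col_tuple; apply: measurable_mulmx => i; exact: measurable_tuple_col.
Qed.

(* An orthogonal [Q] acting on the range of [U] and trivially on its orthogonal
   complement lifts the action of [Q] on [R^k]. *)
Lemma project_symmetric (W : {RV P >-> k.-tuple R}) : W =1 project \o w ->
  spherically_symmetric (distribution P W).
Proof.
move=> WE Q QQ A mA.
pose Q' := U *m Q *m U^T + (1%:M - U *m U^T).
(* Projecting after [Q'] is the same as applying [Q] after projecting. *)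
have UQ' : U^T *m Q' = Q *m U^T.
  by rewrite mulmxDr !mulmxA UU mul1mx mulmxBr mulmx1 mulmxA UU mul1mx subrr addr0.
have QQ' : Q'^T *m Q' = 1%:M.
  have -> : Q'^T = U *m Q^T *m U^T + (1%:M - U *m U^T).
    rewrite /Q' (raddfD (@trmx R d d)) (raddfB (@trmx R d d)) /= trmx1 !trmx_mul !trmxK.
    by rewrite mulmxA.
  rewrite mulmxDl -[_ *m U^T *m Q']mulmxA UQ' mulmxBl mul1mx -[U *m U^T *m Q']mulmxA UQ'.
  by rewrite !mulmxA -(mulmxA U) QQ mulmx1 /Q' addrAC subrr add0r addrC subrK.
have mB := measurable_preimageT measurable_project mA.
have := hw QQ' mB; rewrite /distribution /pushforward.
congr (P _ = P _); apply: funext => t; rewrite /= WE /= /project /linear_act -!/(col_tuple _).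
  by rewrite !col_tupleK !mulmxA UQ'.
by [].
Qed.

(** A nonzero [w] with [U^T w = 0] lies on the punctured hyperplane orthogonal to the first column
    of [U], which is a null set. *)
Lemma project_nonzero : (0 < k)%N ->
  (P [set t | tuple_col (w t) != 0%R] <= P [set t | nonzero k (project (w t))])%E.
Proof.
move=> k0; pose u := col (Ordinal k0) U.
have u0 : u != 0.
  apply/eqP => u0; have : (U^T *m U) (Ordinal k0) (Ordinal k0) = 1.
    by rewrite UU mxE eqxx.
  rewrite mxE big1 => [/esym/eqP|i _]; first by rewrite oner_eq0.
  by have /colP/(_ i) := u0; rewrite !mxE => ->; rewrite mulr0.
have muT : (distribution P w setT < +oo)%E by rewrite probability_setT ltry.
have H0 := mu_punctured_hyperplane0 muT hw u0.
have mH := measurable_punctured_hyperplane u.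
have mpN := measurable_preimageT measurable_project (@measurable_nonzero R k).
apply: (@le_trans _ _ (distribution P w (project @^-1` nonzero k `|` punctured_hyperplane u))).
  apply: (@le_measure _ _ _ (distribution P w) (@nonzero R d)); rewrite ?inE.
  - exact: measurable_nonzero.
  - exact: measurableU.
  move=> x xn; have [xU|xU] := eqVneq (U^T *m tuple_col x) 0.
    right; split=> //=; rewrite dotC dotE.
    have /colP/(_ (Ordinal k0)) := xU; rewrite [RHS]mxE => e; rewrite -[RHS]e !mxE.
    by apply: eq_bigr => i _; rewrite !mxE.
  by left; rewrite /nonzero /project /= col_tupleK.
apply: le_trans (measureU2 _ _ _) _ => //.
by rewrite [X in (_ + X)%E](_ : _ = 0%E) ?adde0//; exact: H0.
Qed.

End Projection.

Lemma symmetric_increasing_cone (R : realType) (k : nat)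
    (nu : {finite_measure set (k.-tuple R) -> \bar R}) (L : 'M[R]_k) (a b : R) :
  (0 < k)%N -> spherically_symmetric nu -> 0 < a -> 0 < b -> L \in unitmx ->
  (forall v, a * enorm v <= enorm (L *m v) <= b * enorm v) ->
  (nu (nonzero k) * ((a / b) ^+ k / k`!%:R)%:E <=
   nu (linear_act L @^-1` increasing_cone (k := k) `&` nonzero k))%E.
Proof.
move=> k0 nu_sym a0 b0 uL Lab.
have [lam [lamS lamB]] := lebesgue_tuple_exists R k.
have mB := @measurable_punctured_ball R k 1.
have Bfin : lam (punctured_ball 1) \is a fin_num by exact: lam_punctured_ball_fin lamB _ _.
have Bgt0 : (0 < lam (punctured_ball 1))%E by exact: lam_punctured_ball_gt0 lamS lamB _ k0 _.
have Boo : (lam (punctured_ball 1) < +oo)%E by rewrite -ge0_fin_numE.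
(* Restricted to the ball, Lebesgue measure becomes finite and stays spherically symmetric, so it
   can be compared with [nu]. *)
pose rho := mfrestr mB Boo.
have rhoE A : rho A = lam (A `&` punctured_ball 1) by [].
have rho_sym : spherically_symmetric rho.
  move=> Q QQ A mA; rewrite !rhoE.
  rewrite -(lam_orthogonal lamS lamB k0 QQ (measurableI _ _ mA mB)); congr (lam _).
  apply: funext => x; rewrite /punctured_ball /= /linear_act -/(col_tuple _) col_tupleK.
  by rewrite enorm_isometry.
have BN : punctured_ball 1 `<=` @nonzero R k.
  by move=> x /= /andP[+ _]; rewrite enorm_gt0.
have mC := @measurable_increasing_cone R k.
have mL := measurable_preimageT (measurable_linear_act L) mC.
have rhoN A : rho (A `&` nonzero k) = lam (A `&` punctured_ball 1).
  by rewrite rhoE -setIA (setIidr BN).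
have rhoT : rho (nonzero k) = lam (punctured_ball 1) by rewrite rhoE (setIidr BN).
have rho_dircone e (u : 'cV[R]_k) : 0 < e -> u != 0 -> (0 < rho (dircone e u))%E.
  move=> e0 u0; rewrite rhoE.
  have un : 0 < enorm u by rewrite enorm_gt0.
  (* Since [e' <= 1], the ball of radius [e' / 8] about [u' / 2] avoids the origin and stays inside
     the unit ball. *)
  pose u' := (enorm u)^-1 *: u; pose e' := Num.min e 1.
  have e'0 : 0 < e' by rewrite /e' lt_min e0 ltr01.
  have u'1 : enorm u' = 1.
    by rewrite enormZ gtr0_norm ?invr_gt0// mulVf// gt_eqF.
  apply: (@lam_gt0 _ _ _ lamS lamB (2^-1 *: u') (e' / 8)); first by rewrite divr_gt0.
    by apply: measurableI => //; exact: measurable_dircone.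
  move=> x xu; have e'1 : e' <= 1 by rewrite /e' ge_min lexx orbT.
  split.
    rewrite /dircone /= -(@dirnear_scale _ _ e (enorm u)^-1) ?invr_gt0// -/u'.
    apply: lt_le_trans (dirnear_half u'1 e'0 e'1 xu) _.
    by rewrite ler_wpM2r ?mulr_ge0 ?enorm_ge0// /e' ge_min lexx.
  have h1 := enormD (tuple_col x - 2^-1 *: u') (2^-1 *: u').
  have h2 := enormD (2^-1 *: u' - tuple_col x) (tuple_col x).
  rewrite subrK enormZ u'1 mulr1 ger0_norm ?invr_ge0// in h1.
  rewrite subrK enormZ u'1 mulr1 ger0_norm ?invr_ge0// in h2.
  rewrite -[enorm (_ - tuple_col x)]enormN opprB in h2.
  by rewrite /punctured_ball /=; apply/andP; split; lra.
have Uopen (x : k.-tuple R) : (linear_act L @^-1` increasing_cone (k := k)) x -> nonzero k x ->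
    exists2 e : R, 0 < e & forall y, dirnear e (tuple_col x) (tuple_col y) ->
      (linear_act L @^-1` increasing_cone (k := k)) y.
  have E (z : k.-tuple R) : (linear_act L @^-1` increasing_cone (k := k)) z =
      increasing (L *m tuple_col z).
    by rewrite /increasing_cone /= /linear_act -/(col_tuple _) col_tupleK.
  rewrite E => xL xn.
  have Lb v : enorm (L *m v) <= b * enorm v by have /andP[] := Lab v.
  have [e e0 eP] := increasing_open b0 Lb xL xn.
  by exists e => // y /eP; rewrite E.
have h1 :
  (nu (nonzero k) * lam (linear_act L @^-1` increasing_cone (k := k) `&` punctured_ball 1) <=
    nu (linear_act L @^-1` increasing_cone (k := k) `&` nonzero k) * lam (punctured_ball 1))%E.
  rewrite -rhoN -rhoT.
  exact: (@symmetric_cone_le _ _ nu rho nu_sym rho_sym rho_dircone _ mL Uopen).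
have Ccone c (x : k.-tuple R) : 0 < c -> increasing_cone x -> increasing_cone (linear_act c%:M x).
  move=> c0 xi; rewrite /increasing_cone /= /linear_act -/(col_tuple _) col_tupleK.
  by rewrite mul_scalar_mx; exact: increasing_scale.
have h2 := linear_act_expansion lamS lamB k0 a0 b0 uL Lab mC Ccone.
have rho_fin : (rho setT < +oo)%E by rewrite rhoE setTI.
have h3 : (lam (punctured_ball 1) <=
    k`!%:R%:E * lam (increasing_cone (k := k) `&` punctured_ball 1))%E.
  by rewrite -rhoN -rhoT; exact: increasing_cone_measure.
have Ifin A : measurable A -> lam (A `&` punctured_ball 1) \is a fin_num.
  move=> mA; rewrite ge0_fin_numE//; apply: (le_lt_trans _ Boo); apply: le_measure; rewrite ?inE//.
  exact: measurableI.
have Nfin A : measurable A -> nu A \is a fin_num by exact: fin_num_measure.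
have mN := @measurable_nonzero R k.
move: h1 h2 h3 Bgt0.
have := Ifin _ mL; have := Ifin _ mC; have := Nfin _ mN; have := Nfin _ (measurableI _ _ mL mN).
move=> /fineK <- /fineK <- /fineK <- /fineK <-; rewrite -(fineK Bfin).
rewrite -!EFinM !lee_fin !lte_fin.
set x1 := fine (lam (_ `&` _)); set x2 := fine (lam (_ `&` _)); set B := fine (lam _).
set n1 := fine (nu _); set n2 := fine (nu _) => h1 h2 h3 B0.
have f0 : 0 < k`!%:R :> R by rewrite ltr0n fact_gt0.
have q0 : 0 <= (a / b) ^+ k by rewrite exprn_ge0// divr_ge0// ltW.
have n10 : 0 <= n1 by exact: fine_ge0.
(* Multiplied by the volume of the ball, the goal is the chain of [h3], [h2] and [h1]. *)
rewrite -(ler_pM2r B0); apply: le_trans h1.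
apply: (@le_trans _ _ (n1 * ((a / b) ^+ k * x2))); last by rewrite ler_wpM2l.
rewrite -mulrA ler_wpM2l// -mulrA ler_wpM2l// mulrC ler_pdivrMr//.
by rewrite mulrC.
Qed.

(** * The uniform induced ordering property *)

Theorem mainTheorem6 (R : realType) (d n k : nat) (delta : R)
    (hd : (0 < d)%N) (hk : (1 <= k <= n)%N) (hdelta : 0 < delta < 1)
    (X : 'M[R]_(d, n)) (hX : restricted_isometry k (delta / k%:R) X)
    (disp : measure_display) (T : measurableType disp) (P : probability T R)
    (w : {RV P >-> d.-tuple R})
    (hw : spherically_symmetric (distribution P w))
    (pi : T -> 'S_n) (hpi : sorting_permutation P X w pi) :
  uniform_induced_ordering P pi k delta.
Proof.
move=> y uy; case/andP: hk => k0 _; case/andP: hdelta => d0 d1.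
have [mpi pi_sorts pi_unif] := hpi.
have kp : 0 < k%:R :> R by rewrite ltr0n.
set e := delta / k%:R in hX.
have e0 : 0 < e by rewrite divr_gt0.
have e1 : e < 1.
  by rewrite ltr_pdivrMr// mul1r (lt_le_trans d1)// ler1n.
set a := Num.sqrt (1 - e); set b := Num.sqrt (1 + e).
have a0 : 0 < a by rewrite sqrtr_gt0 subr_gt0.
have b0 : 0 < b by rewrite sqrtr_gt0 addr_gt0.
(* Since [(a / b)^2 = (1 - e) / (1 + e) >= (1 - e)^2], one has [a / b >= 1 - e]; Bernoulli's
   inequality with [k e = delta] finishes. *)
have ab : 1 - delta <= (a / b) ^+ k.
  have -> : delta = k%:R * e by rewrite mulrC divfK ?gt_eqF.
  apply: le_trans (bernoulli_ineq _ _) _; first by rewrite !ltW.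
  have e1' : 0 <= 1 - e by rewrite subr_ge0 ltW.
  apply: lerXn2r; rewrite ?nnegrE//; first by rewrite divr_ge0// ltW.
  rewrite ler_pdivlMr// -(@ler_pXn2r _ 2)// ?nnegrE; last 2 first.
    by rewrite mulr_ge0// ltW.
    exact: ltW.
  rewrite exprMn !sqr_sqrtr//; last by rewrite addr_ge0// ltW.
  nra.
pose Y := colsub (tnth y) X.
have Yab v : a * enorm v <= enorm (Y *m v) <= b * enorm v.
  have /andP[h1 h2] := restricted_isometry_tuple hX uy v.
  have e1' : 0 <= 1 - e by rewrite subr_ge0 ltW.
  have e2' : 0 <= 1 + e by rewrite addr_ge0// ltW.
  by rewrite /a /b /enorm -!sqrtrM// !ler_wsqrtr.
have Yinj (v : 'cV_k) : Y *m v = 0 -> v = 0.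
  move=> Yv; have /andP[+ _] := Yab v; rewrite Yv enorm0 pmulr_rle0// => v0.
  by apply/eqP; rewrite -enorm_eq0 eq_le v0 enorm_ge0.
have [U [S UU YE]] := qr_decomposition Yinj.
have Sab v : a * enorm v <= enorm (S *m v) <= b * enorm v.
  by have := Yab v; rewrite YE -mulmxA enorm_isometry.
have [uL Lab] := trmx_bounds a0 b0 Sab.
have mW : measurable_fun setT (project U \o w).
  by apply: measurableT_comp => //; exact: measurable_project.
pose W : {RV P >-> k.-tuple R} := HB.pack (project U \o w) (isMeasurableFun.Build _ _ _ _ _ mW).
have W_sym := project_symmetric UU hw (W := W) (fun=> erefl).
have h1 := symmetric_increasing_cone k0 W_sym a0 b0 uL Lab.
have h2 := project_nonzero UU hw k0.
pose A := [pred s : 'S_n | sorted ltn [seq nat_of_ord (s i) | i <- y]].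
pose Z := [set t | tuple_col (w t) = 0%R].
(* Two disjoint parts of the ordering event: [E1] lies over [w = 0], and on [E2] the projection of
   [w] is nonzero and [S^T] maps it to an increasing vector. *)
pose E1 := [set t | Z t /\ pi t \in enum A].
pose E2 := [set t | (linear_act S^T @^-1` increasing_cone (k := k) `&` nonzero k) (W t)].
have mw : measurable_fun setT w by [].
have ZC : Z = ~` (w @^-1` nonzero d).
  apply: funext => t; apply/propext; rewrite /Z /nonzero /=.
  by split=> [->|/negP/negPn/eqP//]; rewrite eqxx.
have mN := measurable_preimageT mw (@measurable_nonzero R d).
have mZ : measurable Z by rewrite ZC; exact: measurableC.
have PE1 : (P Z * (k`!%:R^-1)%:E <= P E1)%E.
  rewrite (measure_fiber_seq P mZ mpi (enum_uniq _)).
  rewrite (eq_bigr (fun=> P Z * (n`!%:R^-1)%:E)%E); last by move=> s _; exact: pi_unif.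
  have -> : (\sum_(i <- enum A) (P Z * (n`!%:R^-1)%:E) =
      #|A|%:R%:E * (P Z * (n`!%:R^-1)%:E))%E.
    by rewrite big_const_seq count_predT -cardE iter_addr addr0 mule_natl.
  rewrite muleCA; apply: lee_wpmul2l => //; rewrite -EFinM lee_fin.
  have f1 : 0 < k`!%:R :> R by rewrite ltr0n fact_gt0.
  have f2 : 0 < n`!%:R :> R by rewrite ltr0n fact_gt0.
  by rewrite ler_pdivlMr// ler_pdivrMl// -natrM ler_nat card_sorted_perm.
have mE1 : measurable E1 by exact: measurable_fiber_seq.
have mC := measurable_preimageT (measurable_linear_act S^T) (@measurable_increasing_cone R k).
have mE2 : measurable E2.
  apply: (measurable_preimageT mW); apply: measurableI mC _; exact: measurable_nonzero.
have E12 : E1 `|` E2 `<=` [set t | sorted ltn [seq nat_of_ord (pi t i) | i <- y]].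
  move=> t [[_]|[]] /=; first by rewrite mem_enum inE.
  rewrite /increasing_cone /= /linear_act -/(col_tuple _) col_tupleK => Wt _.
  apply: sorted_map_tuple => i j ij; apply: pi_sorts; have := Wt i j ij.
  (* As [S^T U^T = Y^T], the coordinates are the inner products of [w] with the chosen columns. *)
  have E (l : 'I_k) : (S^T *m tuple_col (project U (w t))) l ord0 =
      inner (w t) (col (tnth y l) X).
    rewrite /project col_tupleK mulmxA -trmx_mul -YE /inner mxE.
    by apply: eq_bigr => r _; rewrite !mxE mulrC.
  by rewrite !E.
apply: (@le_trans _ _ (P (E1 `|` E2))); last first.
  apply: le_measure; rewrite ?inE//; first exact: measurableU.
  rewrite (_ : [set t | _] = [set t | setT t /\ pi t \in enum A]).
    exact: measurable_fiber_seq.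
  by apply: funext => t; apply/propext; rewrite /= mem_enum inE; split=> [|[]].
rewrite measureU//; last first.
  rewrite -subset0 => t [[+ _] [_]]; rewrite /Z /nonzero /= /project col_tupleK => ->.
  by rewrite mulmx0 eqxx.
have PZ : P Z = (1%:E - P (w @^-1` nonzero d))%E by rewrite ZC probability_setC.
have h3 : (P (w @^-1` nonzero d) * ((1 - delta) / k`!%:R)%:E <= P E2)%E.
  apply: le_trans h1; apply: lee_pmul => //.
    by rewrite lee_fin divr_ge0// subr_ge0 ltW.
  by rewrite lee_fin ler_pM2r// invr_gt0 ltr0n fact_gt0.
(* With [p] the probability of [w <> 0], the sum is [((1 - p) + p (1 - delta)) / k!], which is at
   least [(1 - delta) / k!]. *)
apply: le_trans (leeD PE1 h3); rewrite PZ.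
have pfin : P (w @^-1` nonzero d) \is a fin_num by exact: fin_num_measure.
have p1 := probability_le1 P mN.
move: p1; rewrite -(fineK pfin) -EFinB -!EFinM -EFinD !lee_fin; set p := fine _ => p1.
rewrite mulrA -mulrDl ler_pM2r; last by rewrite invr_gt0 ltr0n fact_gt0.
nra.
Qed.
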